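(* Let $0 < \kappa < 1$, $\lambda = \sqrt{1-\kappa^2}$, and let $P_\kappa = \wp(\,\cdot\,; G_2, G_3)$ with $G_2 = 48(1 + 8\kappa^2)$ and $G_3 = 64(1 - 20\kappa^2 - 8\kappa^4)$. The period lattice of $P_\kappa$ is rectangular, generated by $2\Omega_\kappa$ and $2\Omega_\kappa'$ with $\Omega_\kappa > 0$ real and $\Omega_\kappa'$ purely imaginary with positive imaginary part. Then $$\Omega_\kappa' = {\rm i}\, \tfrac{1}{6\sqrt2}\, \pi \,_2F_1 (\tfrac{1}{3}, \tfrac{2}{3}; 1; \lambda^2).$$
   Context: $\wp(\,\cdot\,; g_2, g_3)$ denotes the Weierstrass elliptic function with invariants $g_2, g_3$; $\,_2F_1$ is the Gauss hypergeometric function. *)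

(* Defs.v *)
From Stdlib Require Import Reals ZArith List.
From Coquelicot Require Import Coquelicot.
Open Scope R_scope.

Definition lattice_pt (w1 w2 : C) (m n : Z) : C :=
  Cplus (Cmult (RtoC (2 * IZR m)) w1) (Cmult (RtoC (2 * IZR n)) w2).

Definition zrange (N : nat) : list Z :=
  map (fun k => (Z.of_nat k - Z.of_nat N)%Z) (seq 0 (2 * N + 1)).

Definition eis_partial (k : nat) (w1 w2 : C) (N : nat) : C :=
  fold_right Cplus (RtoC 0)
    (flat_map (fun m =>
       map (fun n =>
         if (Z.eqb m 0 && Z.eqb n 0)%bool then RtoC 0
         else Cinv (Cpow (lattice_pt w1 w2 m n) k))
       (zrange N)) (zrange N)).

(** The (absolutely convergent, k >= 3) lattice sum  sum'_{w in Lambda} w^(-k)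
    equals s. *)
Definition is_eisenstein (k : nat) (w1 w2 : C) (s : C) : Prop :=
  filterlim (eis_partial k w1 w2) eventually (locally s).

(** The lattice generated by 2 w1, 2 w2 has Weierstrass invariants g2, g3:
    g2 = 60 sum' w^-4,  g3 = 140 sum' w^-6.  Equivalently, wp(.; g2, g3) is the
    Weierstrass function of this lattice, i.e. this is its period lattice. *)
Definition has_invariants (w1 w2 : C) (g2 g3 : R) : Prop :=
  is_eisenstein 4 w1 w2 (RtoC (g2 / 60)) /\ is_eisenstein 6 w1 w2 (RtoC (g3 / 140)).

Fixpoint pochhammer (a : R) (n : nat) : R :=
  match n with
  | O => 1
  | S n' => pochhammer a n' * (a + INR n')
  end.

Definition hyp2F1 (a b c x : R) : R :=
  Series (fun n => pochhammer a n * pochhammer b n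
                   / (pochhammer c n * INR (fact n)) * x ^ n).

(* Main.v *)
Require Import Defs.
From Stdlib Require Import Reals Lra Lia ZArith List.
From Coquelicot Require Import Coquelicot.
Open Scope R_scope.

(** Write [Omega = Om] and [Omega' = i s].  Summing the lattice along the rows parallel to
    [Omega'] turns [g2] and [g3] into the Lambert series [Q = 1 + 240 sum d^3 q^d/(1 - q^d)]
    and [R = 1 - 504 sum d^5 q^d/(1 - q^d)] with [q = exp (- h)], [h = 2 PI Om / s]; a row is
    evaluated by iterating the duplication formula of [1/sin^2].

    With [L_a = 1/(e^(a h) - 1)] one has [L_a L_b = L_(a+b) (1 + L_a + L_b)].  Weighting this
    by a form [T(a, b, - a - b)] with [T] symmetric and even, and summing over all [a, b >= 1],
    gives Ramanujan's differential equations for [P, Q, R].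

    Parametrize [Q = a^4 (1 - 8x/9)], [R = a^6 (1 - 4x/3 + 8x^2/27)].  Ramanujan's equations
    say that [a], as a function of [x], solves the equation of [2F1(1/3, 2/3; 1; x)].  As
    [h -> oo] one has [x -> 0], [a -> 1] and the Wronskian tends to [0], so that
    [a = 2F1(1/3, 2/3; 1; x)] everywhere.  For the given invariants [x = 1 - kappa^2] and
    [a = 6 sqrt 2 s / PI]. *)

(** * Finite sums and dominated convergence of series *)

(** The parametrization is that of the cubic theta functions: [a] and [x] are a(t) and c(t)^3/a(t)^3
    at t = q^(1/3), for which Q(t) = a^4 (1 + 8x), Q(t^3) = a^4 (1 - 8x/9), and likewise for R. The
    theorem states its invariants in the first form, in kappa^2; substituting kappa^2 = 1 - lambda^2
    brings them to the second. With rows parallel to Omega', [s] is the unit of length of a row, so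
    that [a] comes out proportional to [s].

    The hypothesis gives Q and R at one value of h, whereas the initial condition of the
    differential equation lies at h = oo. Hence a and x must be functions of h on a whole half line,
    recovered from Q and R alone. This is the inversion of a quartic, possible while Q^3 - R^2 > 0,
    and that inequality has to be carried from h to oo. The inversion degenerates exactly in the
    limit, where the quartic gets a triple root.

    No complex function theory enters: the invariants being real, real parts of the lattice sums
    suffice, and row sums are rational in the real and imaginary part of sin^2. *)

Fixpoint psum (f : nat -> R) (n : nat) : R :=
  match n with
  | O => 0
  | S m => psum f m + f m
  end.

Lemma psum_ext_lt (f g : nat -> R) (n : nat) :
  (forall i, (i < n)%nat -> f i = g i) -> psum f n = psum g n.
Proof.
  induction n as [|n IH]; intros H; simpl; auto.
  rewrite IH, H; auto; intros; apply H; lia.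
Qed.

Lemma psum_ext (f g : nat -> R) (n : nat) :
  (forall i, f i = g i) -> psum f n = psum g n.
Proof. intros H; apply psum_ext_lt; auto. Qed.

Lemma psum_plus (f g : nat -> R) (n : nat) :
  psum (fun i => f i + g i) n = psum f n + psum g n.
Proof. induction n as [|n IH]; simpl; [ring | rewrite IH; ring]. Qed.

Lemma psum_scal (c : R) (f : nat -> R) (n : nat) :
  psum (fun i => c * f i) n = c * psum f n.
Proof. induction n as [|n IH]; simpl; [ring | rewrite IH; ring]. Qed.

Lemma psum_first (f : nat -> R) (n : nat) :
  psum f (S n) = f 0%nat + psum (fun i => f (S i)) n.
Proof.
  induction n as [|n IH]; [simpl; ring|].
  change (psum f (S n) + f (S n) = f 0%nat + (psum (fun i => f (S i)) n + f (S n))).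
  rewrite IH; ring.
Qed.

Lemma psum_rev (f : nat -> R) (n : nat) :
  psum (fun i => f (n - 1 - i)%nat) n = psum f n.
Proof.
  induction n as [|n IH]; auto.
  rewrite psum_first. simpl psum at 2. rewrite <- IH, Rplus_comm. f_equal.
  - apply psum_ext_lt; intros i Hi; f_equal; lia.
  - f_equal; lia.
Qed.

Lemma psum_add (f : nat -> R) (m n : nat) :
  psum f (m + n) = psum f m + psum (fun i => f (m + i)%nat) n.
Proof.
  induction n as [|n IH]; simpl; [rewrite Nat.add_0_r; ring|].
  rewrite Nat.add_succ_r; simpl; rewrite IH; ring.
Qed.

(** Each index of the first half is paired with its mirror image; the refinement of a row sum
    produces its terms in this order. *)
Lemma psum_fold (f : nat -> R) (n : nat) :
  psum (fun i => f i + f (2 * n - 1 - i)%nat) n = psum f (2 * n).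
Proof.
  replace (2 * n)%nat with (n + n)%nat by lia.
  rewrite psum_plus, psum_add. f_equal.
  rewrite <- (psum_rev (fun i => f (n + i)%nat)).
  apply psum_ext_lt; intros i Hi; f_equal; lia.
Qed.

Lemma psum_le (f g : nat -> R) (n : nat) :
  (forall i, (i < n)%nat -> f i <= g i) -> psum f n <= psum g n.
Proof.
  induction n as [|n IH]; intros H; simpl; [lra|].
  apply Rplus_le_compat; [apply IH; intros; apply H|apply H]; lia.
Qed.

Lemma psum_abs (f : nat -> R) (n : nat) :
  Rabs (psum f n) <= psum (fun i => Rabs (f i)) n.
Proof.
  induction n as [|n IH]; simpl; [rewrite Rabs_R0; lra|].
  eapply Rle_trans; [apply Rabs_triang | lra].
Qed.

Lemma sum_f_R0_psum (f : nat -> R) (n : nat) : sum_f_R0 f n = psum f (S n).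
Proof. induction n as [|n IH]; [simpl; ring | simpl in *; rewrite IH; ring]. Qed.

Lemma is_series_psum (a : nat -> R) (l : R) :
  is_series a l <-> is_lim_seq (psum a) l.
Proof.
  assert (E : forall n, sum_n a n = psum a (S n)).
  { intros n; rewrite sum_n_Reals; apply sum_f_R0_psum. }
  split; intros H.
  - apply is_lim_seq_incr_1. apply is_lim_seq_ext with (2 := H); auto.
  - apply is_lim_seq_incr_1 in H. unfold is_series.
    apply (filterlim_ext (fun n => psum a (S n))); auto.
Qed.

Lemma Series_psum_eventually_zero (a : nat -> R) (N : nat) :
  (forall n, (N <= n)%nat -> a n = 0) -> Series a = psum a N.
Proof.
  intros H. apply is_series_unique, is_series_psum.
  apply is_lim_seq_ext_loc with (fun _ => psum a N); [|apply is_lim_seq_const].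
  exists N; intros n Hn.
  replace n with (N + (n - N))%nat by lia. rewrite psum_add.
  rewrite (psum_ext (fun i => a (N + i)%nat) (fun _ => 0 * 0)).
  - rewrite psum_scal; ring.
  - intros i; rewrite H by lia; ring.
Qed.

Lemma psum_le_Series (a : nat -> R) (N : nat) :
  (forall n, 0 <= a n) -> ex_series a -> psum a N <= Series a.
Proof.
  intros Ha [l Hl]. rewrite (is_series_unique _ _ Hl).
  apply is_series_psum in Hl.
  apply (is_lim_seq_incr_compare _ _ Hl). intros n; simpl; specialize (Ha n); lra.
Qed.

Lemma ex_series_Rle (a b : nat -> R) :
  (forall n, Rabs (a n) <= b n) -> ex_series b -> ex_series a.
Proof. intros H; apply (ex_series_le (V := R_CompleteNormedModule) a b H). Qed.

Lemma Series_Rabs_le (a b : nat -> R) :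
  (forall n, Rabs (a n) <= b n) -> ex_series b -> Rabs (Series a) <= Series b.
Proof.
  intros H Hb. eapply Rle_trans.
  - apply Series_Rabs, (ex_series_Rle _ b); auto. intros n; rewrite Rabs_Rabsolu; auto.
  - apply Series_le; auto. intros n; split; auto; apply Rabs_pos.
Qed.

Lemma Series_tail_small (b : nat -> R) (eps : R) :
  ex_series b -> 0 < eps ->
  exists N, (0 < N)%nat /\ Rabs (Series (fun k => b (N + k)%nat)) < eps.
Proof.
  intros Hb He.
  assert (H := proj1 (is_series_psum _ _) (Series_correct _ Hb)).
  apply is_lim_seq_spec in H. destruct (H (mkposreal _ He)) as [N HN]. simpl in HN.
  exists (S N). split; [lia|].
  specialize (HN (S N) (Nat.le_succ_diag_r N)).
  rewrite (Series_incr_n b (S N)) in HN; [|lia|auto].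
  simpl pred in HN; rewrite sum_f_R0_psum in HN.
  rewrite Rabs_minus_sym in HN.
  replace (psum b (S N) + Series (fun k => b (S N + k)%nat) - psum b (S N))
    with (Series (fun k => b (S N + k)%nat)) in HN by ring. exact HN.
Qed.

Lemma filterlim_psum {T} (F : (T -> Prop) -> Prop) {FF : Filter F}
  (a : T -> nat -> R) (l : nat -> R) (N : nat) :
  (forall n, filterlim (fun x => a x n) F (locally (l n))) ->
  filterlim (fun x => psum (a x) N) F (locally (psum l N)).
Proof.
  intros H; induction N as [|N IH]; simpl.
  - apply filterlim_const.
  - eapply filterlim_comp_2; [exact IH | exact (H N) | ].
    apply (filterlim_plus (V := R_NormedModule)).
Qed.

Section Dominated.
Context {T : Type} (F : (T -> Prop) -> Prop) {FF : ProperFilter F}.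
Variables (a : T -> nat -> R) (l b : nat -> R).
Hypothesis Hb : ex_series b.
Hypothesis Hab : F (fun x => forall n, Rabs (a x n) <= b n).
Hypothesis Hl : forall n, filterlim (fun x => a x n) F (locally (l n)).

Lemma dominated_limit_bound (n : nat) : Rabs (l n) <= b n.
Proof.
  apply le_epsilon; intros e He.
  assert (H := proj1 (filterlim_locally _ _) (Hl n) (mkposreal e He)).
  destruct (filter_ex _ (filter_and _ _ H Hab)) as [x [H1 H2]].
  specialize (H2 n). unfold ball in H1; simpl in H1.
  unfold AbsRing_ball, abs, minus, plus, opp in H1; simpl in H1.
  revert H1 H2; unfold Rabs; repeat destruct Rcase_abs; lra.
Qed.

Lemma dominated_limit_ex_series : ex_series l.
Proof. apply (ex_series_Rle l b); [exact dominated_limit_bound | exact Hb]. Qed.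

(** Tannery's theorem: finitely many terms converge, and both tails are below the tail of [b]. The
    filter is arbitrary because the statement serves sequences as well as difference quotients. *)
Lemma filterlim_Series_dominated :
  filterlim (fun x => Series (a x)) F (locally (Series l)).
Proof.
  apply filterlim_locally; intros eps.
  assert (He : 0 < eps / 3) by (destruct eps; simpl; lra).
  destruct (Series_tail_small b _ Hb He) as [N [HN Ht]].
  assert (HbN : ex_series (fun k => b (N + k)%nat)) by (apply ex_series_incr_n; auto).
  assert (HP := proj1 (filterlim_locally _ _) (filterlim_psum F a l N Hl) (mkposreal _ He)).
  generalize (filter_and _ _ HP Hab). apply filter_imp; intros x [H1 H2].
  unfold ball in *; simpl in *.
  unfold AbsRing_ball, abs, minus, plus, opp in *; simpl in *.
  assert (Ea : ex_series (a x)) by (apply (ex_series_Rle _ b); auto).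
  rewrite (Series_incr_n (a x) N), (Series_incr_n l N);
    auto using dominated_limit_ex_series.
  rewrite !sum_f_R0_psum. replace (S (pred N)) with N by lia.
  assert (T1 : Rabs (Series (fun k => a x (N + k)%nat)) <= Series (fun k => b (N + k)%nat)).
  { apply Series_Rabs_le; auto. }
  assert (T2 : Rabs (Series (fun k => l (N + k)%nat)) <= Series (fun k => b (N + k)%nat)).
  { apply Series_Rabs_le; auto. intros; apply dominated_limit_bound. }
  assert (T3 := Rle_lt_trans _ _ _ (Rle_abs _) Ht).
  apply Rabs_def2 in H1. apply Rabs_le_between in T1. apply Rabs_le_between in T2.
  apply Rabs_def1; lra.
Qed.

End Dominated.

(** By the mean value theorem each difference quotient of [f n] is a value of [df n] near [x], hence
    dominated by [b n]; the rest is dominated convergence along the punctured neighbourhood of 0. *)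
Lemma is_derive_Series_dominated (f df : nat -> R -> R) (b : nat -> R) (x d : R) :
  0 < d -> ex_series b ->
  (forall y, Rabs (y - x) < d -> ex_series (fun n => f n y)) ->
  (forall n y, Rabs (y - x) < d -> is_derive (f n) y (df n y)) ->
  (forall n y, Rabs (y - x) < d -> Rabs (df n y) <= b n) ->
  is_derive (fun y => Series (fun n => f n y)) x (Series (fun n => df n x)).
Proof.
  intros Hd Hb Hex Hder Hbd.
  assert (L : filterlim (fun e => Series (fun n => (f n (x + e) - f n x) / e))
    (locally' 0) (locally (Series (fun n => df n x)))).
  { apply (filterlim_Series_dominated (FF := Rbar_locally'_filter 0) (locally' 0) _ _ b Hb).
    - exists (mkposreal d Hd). intros e He0 He n.
      unfold ball in He0; simpl in He0; unfold AbsRing_ball, abs, minus, plus, opp in He0;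
        simpl in He0. rewrite Ropp_0, Rplus_0_r in He0.
      assert (HI : forall z, Rmin x (x + e) <= z <= Rmax x (x + e) -> Rabs (z - x) < d).
      { intros z Hz. apply Rabs_def2 in He0. revert Hz; unfold Rmin, Rmax.
        destruct Rle_dec; intros; apply Rabs_def1; lra. }
      destruct (MVT_gen (f n) x (x + e) (df n)) as [c [Hc E]].
      + intros z Hz; apply Hder, HI; lra.
      + intros z Hz. apply derivable_continuous_pt. exists (df n z).
        apply is_derive_Reals, Hder, HI; auto.
      + rewrite E. replace (df n c * (x + e - x) / e) with (df n c) by (field; auto).
        apply Hbd, HI; auto.
    - intros n. assert (D : is_derive (f n) x (df n x)).
      { apply Hder. rewrite Rminus_eq_0, Rabs_R0; auto. }
      apply is_derive_Reals in D. apply filterlim_locally; intros eps.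
      destruct (D eps (cond_pos eps)) as [del Hdel].
      exists del. intros e He He0.
      unfold ball in *; simpl in *; unfold AbsRing_ball, abs, minus, plus, opp in *; simpl in *.
      apply Hdel; auto. rewrite Ropp_0, Rplus_0_r in He; auto. }
  apply is_derive_Reals. intros eps He.
  destruct (proj1 (filterlim_locally _ _) L (mkposreal eps He)) as [del Hdel].
  assert (Hm : 0 < Rmin del d) by (apply Rmin_pos; auto; apply cond_pos).
  exists (mkposreal _ Hm). simpl. intros e He0 He1.
  assert (He2 : Rabs e < del) by (eapply Rlt_le_trans; [exact He1 | apply Rmin_l]).
  assert (He3 : Rabs e < d) by (eapply Rlt_le_trans; [exact He1 | apply Rmin_r]).
  assert (B : ball 0 del e).
  { unfold ball; simpl; unfold AbsRing_ball, abs, minus, plus, opp; simpl.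
    rewrite Ropp_0, Rplus_0_r; auto. }
  specialize (Hdel e B He0).
  unfold ball in Hdel; simpl in Hdel; unfold AbsRing_ball, abs, minus, plus, opp in Hdel;
    simpl in Hdel.
  rewrite <- Series_minus.
  2: { apply Hex. replace (x + e - x) with e by ring; auto. }
  2: { apply Hex. rewrite Rminus_eq_0, Rabs_R0; auto. }
  unfold Rdiv at 1. rewrite <- Series_scal_r. exact Hdel.
Qed.

(** * Lambert series and Ramanujan's differential equations *)

(** Multiplying the coefficients by n is differentiation followed by a shift, and neither changes
    the radius. *)
Lemma CV_radius_INR_pow (j : nat) : Rbar_le 1 (CV_radius (fun n => INR n ^ j)).
Proof.
  induction j as [|j IH].
  - apply (CV_radius_bounded (fun n => INR n ^ 0)). exists 1.
    intros n; simpl; rewrite pow1, Rmult_1_r, Rabs_R1; lra.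
  - rewrite (CV_radius_ext _ (PS_incr_1 (PS_derive (fun n => INR n ^ j)))).
    + rewrite CV_radius_incr_1, CV_radius_derive; exact IH.
    + intros [|n]; [simpl; unfold zero; simpl; ring | reflexivity].
Qed.

Lemma ex_series_INR_pow_geom (j : nat) (w : R) :
  Rabs w < 1 -> ex_series (fun n => INR n ^ j * w ^ n).
Proof.
  intros Hw. apply ex_series_Rabs, CV_disk_inside.
  eapply Rbar_lt_le_trans; [|apply CV_radius_INR_pow]. exact Hw.
Qed.

(** The Euler operator w d/dw raises the exponent of n by one; iterated from the geometric series it
    yields closed forms. *)
Lemma is_series_INR_pow_geom_S (j : nat) (g g' : R -> R) :
  (forall w, Rabs w < 1 -> is_series (fun n => INR n ^ j * w ^ n) (g w)) ->
  (forall w, Rabs w < 1 -> is_derive g w (g' w)) ->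
  forall w, Rabs w < 1 -> is_series (fun n => INR n ^ S j * w ^ n) (w * g' w).
Proof.
  intros Hg Hg' w Hw.
  assert (R1 : Rbar_lt (Rabs w) (CV_radius (fun n => INR n ^ j))).
  { eapply Rbar_lt_le_trans; [|apply CV_radius_INR_pow]. exact Hw. }
  assert (E : PSeries (PS_derive (fun n => INR n ^ j)) w = g' w).
  { rewrite <- (is_derive_unique _ _ _ (is_derive_PSeries _ _ R1)).
    apply is_derive_unique, is_derive_ext_loc with (2 := Hg' w Hw).
    assert (Hd : 0 < 1 - Rabs w) by lra.
    exists (mkposreal _ Hd). intros z Hz.
    unfold ball in Hz; simpl in Hz; unfold AbsRing_ball, abs, minus, plus, opp in Hz; simpl in Hz.
    symmetry; apply is_series_unique, Hg.
    revert Hz; unfold Rabs; repeat destruct Rcase_abs; lra. }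
  rewrite <- E, <- PSeries_incr_1.
  apply (is_series_ext (fun n => PS_incr_1 (PS_derive (fun n => INR n ^ j)) n * w ^ n)).
  - intros [|n]; [simpl; unfold zero; simpl; ring | reflexivity].
  - apply Series_correct. apply ex_series_Rabs, CV_disk_inside.
    rewrite CV_radius_incr_1, CV_radius_derive; exact R1.
Qed.

Definition lam (a : nat) (h : R) : R := / (exp (INR a * h) - 1).
Definition mom (i : nat) (h : R) : R := Series (fun a => INR a ^ i * lam a h).
Definition mom2 (i : nat) (h : R) : R := Series (fun a => INR a ^ i * lam a h ^ 2).

(** By the convention / 0 = 0. It lets all Lambert series start at the index 0. *)
Lemma lam_0 (h : R) : lam 0 h = 0.
Proof. unfold lam; simpl. rewrite Rmult_0_l, exp_0, Rminus_eq_0. apply Rinv_0. Qed.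

Lemma exp_INR_mul (a : nat) (h : R) : exp (INR a * h) = exp h ^ a.
Proof.
  induction a as [|a IH]; [simpl; rewrite Rmult_0_l; apply exp_0|].
  rewrite S_INR, Rmult_plus_distr_r, exp_plus, IH, Rmult_1_l; simpl; ring.
Qed.

Lemma exp_INR_mul_gt_1 (a : nat) (h : R) : (0 < a)%nat -> 0 < h -> 1 < exp (INR a * h).
Proof.
  intros Ha Hh. rewrite <- exp_0. apply exp_increasing.
  apply Rmult_lt_0_compat; auto. apply lt_0_INR; auto.
Qed.

Lemma exp_neg_lt_1 (h : R) : 0 < h -> 0 < exp (- h) < 1.
Proof. intros H; split; [apply exp_pos | rewrite <- exp_0; apply exp_increasing; lra]. Qed.

Lemma lam_ge_0 (a : nat) (h : R) : 0 < h -> 0 <= lam a h.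
Proof.
  intros Hh. destruct a as [|a]; [rewrite lam_0; lra|].
  left; apply Rinv_0_lt_compat.
  assert (H := exp_INR_mul_gt_1 (S a) h (Nat.lt_0_succ a) Hh); lra.
Qed.

Lemma lam_le (a : nat) (d h : R) :
  0 < d <= h -> lam a h <= exp (- h) ^ a / (1 - exp (- d)).
Proof.
  intros [Hd Hh]. destruct (exp_neg_lt_1 d Hd) as [E1 E2].
  assert (Eh : 0 < exp (- h)) by apply exp_pos.
  destruct a as [|a].
  - rewrite lam_0; simpl. apply Rlt_le, Rdiv_lt_0_compat; lra.
  - unfold lam. assert (HX := exp_INR_mul_gt_1 (S a) h (Nat.lt_0_succ a) ltac:(lra)).
    replace (exp (- h) ^ S a) with (/ exp (INR (S a) * h)).
    2:{ rewrite exp_INR_mul, exp_Ropp, pow_inv; reflexivity. }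
    assert (Hle : exp d <= exp (INR (S a) * h)).
    { assert (d <= INR (S a) * h).
      { rewrite S_INR. assert (0 <= INR a) by apply pos_INR. nra. }
      destruct H; [left; apply exp_increasing; auto | rewrite H; lra]. }
    revert E2 HX Hle. rewrite exp_Ropp. assert (Hp : 0 < exp d) by apply exp_pos.
    set (X := exp (INR (S a) * h)). set (D := exp d) in *. intros E2 HX Hle.
    assert (HD : 1 < D). { apply Rmult_lt_compat_l with (r := D) in E2; auto.
      rewrite Rinv_r in E2; lra. }
    unfold Rdiv. rewrite <- Rinv_mult. apply Rinv_le_contravar.
    + apply Rmult_lt_0_compat; lra.
    + assert (1 <= X * / D).
      { apply Rmult_le_reg_r with D; auto. rewrite Rmult_assoc, Rinv_l; lra. }
      lra.
Qed.

Lemma lam_le_const (a : nat) (d h : R) : 0 < d <= h -> lam a h <= / (1 - exp (- d)).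
Proof.
  intros H. eapply Rle_trans; [apply (lam_le a d h H)|].
  destruct (exp_neg_lt_1 d (proj1 H)). destruct (exp_neg_lt_1 h ltac:(lra)).
  unfold Rdiv. rewrite <- (Rmult_1_l (/ (1 - exp (- d)))) at 2.
  apply Rmult_le_compat_r; [left; apply Rinv_0_lt_compat; lra|].
  rewrite <- (pow1 a). apply pow_incr; lra.
Qed.

(** One factor [lam a h] supplies the geometric decay, uniformly for h >= d; a second one is merely
    bounded by a constant. *)
Lemma lam_pow_bound (i e a : nat) (d h : R) :
  0 < d <= h -> (e = 1 \/ e = 2)%nat ->
  0 <= INR a ^ i * lam a h ^ e <= (/ (1 - exp (- d))) ^ e * (INR a ^ i * exp (- d) ^ a).
Proof.
  intros H He. assert (Hi : 0 <= INR a ^ i) by apply pow_le, pos_INR.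
  assert (L0 := lam_ge_0 a h ltac:(lra)).
  assert (L1 := lam_le a d h H). assert (L2 := lam_le_const a d h H).
  destruct (exp_neg_lt_1 d (proj1 H)).
  assert (C0 : 0 < / (1 - exp (- d))) by (apply Rinv_0_lt_compat; lra).
  assert (Hw : exp (- h) ^ a <= exp (- d) ^ a).
  { apply pow_incr; split; [left; apply exp_pos|].
    destruct (proj2 H); [left; apply exp_increasing; lra | right; f_equal; lra]. }
  assert (L3 : lam a h <= / (1 - exp (- d)) * exp (- d) ^ a).
  { eapply Rle_trans; [exact L1|]. unfold Rdiv. rewrite Rmult_comm.
    apply Rmult_le_compat_l; lra. }
  assert (Hp : 0 <= lam a h ^ e) by (apply pow_le; auto).
  split; [apply Rmult_le_pos; auto|].
  set (c := / (1 - exp (- d))) in *. set (w := exp (- d) ^ a) in *.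
  destruct He; subst e; simpl; rewrite !Rmult_1_r.
  - replace (c * (INR a ^ i * w)) with (INR a ^ i * (c * w)) by ring.
    apply Rmult_le_compat_l; auto.
  - replace (c * c * (INR a ^ i * w)) with (INR a ^ i * (c * (c * w))) by ring.
    apply Rmult_le_compat_l; auto. apply Rmult_le_compat; auto.
Qed.

Lemma ex_series_bound (i e : nat) (d : R) :
  0 < d -> ex_series (fun a => (/ (1 - exp (- d))) ^ e * (INR a ^ i * exp (- d) ^ a)).
Proof.
  intros Hd. apply (ex_series_scal_l (V := R_NormedModule)).
  apply ex_series_INR_pow_geom. destruct (exp_neg_lt_1 d Hd). rewrite Rabs_pos_eq; lra.
Qed.

Lemma ex_series_mom_gen (i e : nat) (h : R) :
  0 < h -> (e = 1 \/ e = 2)%nat -> ex_series (fun a => INR a ^ i * lam a h ^ e).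
Proof.
  intros Hh He. apply (ex_series_Rle _ _) with (2 := ex_series_bound i e h Hh).
  intros a. destruct (lam_pow_bound i e a h h ltac:(lra) He).
  rewrite Rabs_pos_eq; auto.
Qed.

Lemma ex_series_mom (i : nat) (h : R) : 0 < h -> ex_series (fun a => INR a ^ i * lam a h).
Proof.
  intros Hh. eapply ex_series_ext; [|apply (ex_series_mom_gen i 1 h Hh); auto].
  intros a; simpl; ring.
Qed.

Lemma ex_series_mom2 (i : nat) (h : R) : 0 < h -> ex_series (fun a => INR a ^ i * lam a h ^ 2).
Proof. intros Hh. apply ex_series_mom_gen; auto. Qed.

Lemma is_derive_lam (a : nat) (h : R) :
  0 < h -> is_derive (lam a) h (- (INR a * (lam a h + lam a h ^ 2))).
Proof.
  intros Hh. destruct a as [|a].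
  - apply is_derive_ext with (fun _ => 0); [intros; symmetry; apply lam_0|].
    replace (- (INR 0 * (lam 0 h + lam 0 h ^ 2))) with 0 by (simpl; ring).
    apply (is_derive_const (K := R_AbsRing) (V := R_NormedModule)).
  - assert (H := exp_INR_mul_gt_1 (S a) h (Nat.lt_0_succ a) Hh).
    unfold lam. set (c := INR (S a)) in *. auto_derive; [lra|]. field. lra.
Qed.

(** The derivative of L = 1/(e^(ah) - 1) is - a (L + L^2). Thus the second moments [mom2] appear,
    and eliminating them is the purpose of the sums over pairs below. *)
Lemma is_derive_mom (i : nat) (h : R) :
  0 < h -> is_derive (mom i) h (- (mom (S i) h + mom2 (S i) h)).
Proof.
  intros Hh. set (d := h / 2). assert (Hd : 0 < d) by (unfold d; lra).
  assert (HI : forall y, Rabs (y - h) < d -> 0 < d <= y).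
  { intros y Hy. apply Rabs_def2 in Hy. unfold d in *; lra. }
  replace (- (mom (S i) h + mom2 (S i) h)) with
    (Series (fun a => INR a ^ i * (- (INR a * (lam a h + lam a h ^ 2))))).
  - unfold mom. set (C := / (1 - exp (- d))).
    apply is_derive_Series_dominated with
      (df := fun a h => INR a ^ i * (- (INR a * (lam a h + lam a h ^ 2))))
      (b := fun a => C ^ 1 * (INR a ^ S i * exp (- d) ^ a)
                     + C ^ 2 * (INR a ^ S i * exp (- d) ^ a)) (d := d); auto.
    + apply (ex_series_plus (V := R_NormedModule)); apply ex_series_bound; auto.
    + intros y Hy. apply ex_series_mom. specialize (HI y Hy); lra.
    + intros a y Hy. apply (is_derive_scal (lam a)). apply is_derive_lam.
      specialize (HI y Hy); lra.
    + intros a y Hy. specialize (HI y Hy).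
      replace (INR a ^ i * - (INR a * (lam a y + lam a y ^ 2))) with
        (- (INR a ^ S i * lam a y ^ 1 + INR a ^ S i * lam a y ^ 2)) by (simpl; ring).
      assert (B1 := lam_pow_bound (S i) 1 a d y HI ltac:(auto)).
      assert (B2 := lam_pow_bound (S i) 2 a d y HI ltac:(auto)).
      rewrite Rabs_Ropp, Rabs_pos_eq; fold C in B1, B2; lra.
  - unfold mom, mom2. rewrite <- Series_plus, <- Series_opp.
    + apply Series_ext; intros a; simpl; ring.
    + apply ex_series_mom; auto.
    + apply ex_series_mom2; auto.
Qed.

(** * Sums over pairs: antidiagonals against squares *)

Definition tri (l : nat -> R) (s : R -> R -> R) (N : nat) : R :=
  psum (fun d => psum (fun a => s (INR a) (INR (d - a)) * (l a * l (d - a)%nat)) (S d)) N.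

Definition sq (l : nat -> R) (s : R -> R -> R) (N : nat) : R :=
  psum (fun d => psum (fun a => s (INR a) (INR d) * (l a * l d)) N) N.

(** The square gains a row, a column equal to it by symmetry, and a corner. *)
Lemma sq_S (l : nat -> R) (s : R -> R -> R) (d : nat) :
  (forall x y, s x y = s y x) ->
  sq l s (S d) = sq l s d + 2 * (l d * psum (fun a => s (INR a) (INR d) * l a) d)
                 + s (INR d) (INR d) * l d ^ 2.
Proof.
  intros Hs. unfold sq. cbn [psum]. rewrite psum_plus.
  rewrite (psum_ext (fun i => s (INR d) (INR i) * (l d * l i))
             (fun a => l d * (s (INR a) (INR d) * l a))).
  2:{ intros; rewrite Hs; ring. }
  rewrite (psum_ext (fun a => s (INR a) (INR d) * (l a * l d))
             (fun a => l d * (s (INR a) (INR d) * l a))).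
  2:{ intros; ring. }
  rewrite psum_scal. ring.
Qed.

(* The addition rule replaces every product l_a l_(d-a) on the antidiagonal a + (d-a) = d
   by products with l_d; the latter are the row that [sq_S] adds to a square sum. *)
Lemma antidiagonal_sum (l : nat -> R) (s s' : R -> R -> R) (d : nat) :
  l 0%nat = 0 ->
  (forall a b, (0 < a)%nat -> (0 < b)%nat -> l a * l b = l (a + b)%nat * (1 + l a + l b)) ->
  (forall x y, s x y = s y x) -> (forall x y, s x (y - x) = s' x y) ->
  psum (fun a => s (INR a) (INR (d - a)) * (l a * l (d - a)%nat)) (S d) =
  l d * psum (fun i => s (INR (S i)) (INR d - INR (S i))) (d - 1)
  + 2 * (l d * psum (fun a => s' (INR a) (INR d) * l a) d).
Proof.
  intros L0 Ladd Hs Hs'. destruct d as [|m]; [simpl; rewrite L0; ring|].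
  rewrite psum_first, (psum_first (fun a => s' (INR a) (INR (S m)) * l a)).
  cbn [psum]. rewrite Nat.sub_diag, L0.
  replace (S m - 1)%nat with m by lia.
  change (fun i => s (INR (S i)) (INR (S m - S i)) * (l (S i) * l (S m - S i)%nat))
    with (fun i => s (INR (S i)) (INR (m - i)) * (l (S i) * l (m - i)%nat)).
  set (u := fun i => s (INR (S i)) (INR (S m) - INR (S i))).
  assert (E : psum (fun i => s (INR (S i)) (INR (m - i)) * (l (S i) * l (m - i)%nat)) m
    = psum (fun i => l (S m) * (u i + (u i * l (S i) + u i * l (m - i)%nat))) m).
  { apply psum_ext_lt; intros i Hi. rewrite (Ladd (S i) (m - i)%nat) by lia.
    replace (S i + (m - i))%nat with (S m) by lia. unfold u.
    rewrite minus_INR, !S_INR by lia.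
    replace (INR m + 1 - (INR i + 1)) with (INR m - INR i) by ring. ring. }
  rewrite E, psum_scal, psum_plus, psum_plus.
  (* The reflection a -> d - a sends the terms with l_(d-a) to those with l_a; hence the factor 2 in
     the statement. *)
  assert (E2 : psum (fun i => u i * l (m - i)%nat) m = psum (fun i => u i * l (S i)) m).
  { rewrite <- (psum_rev (fun i => u i * l (S i))). apply psum_ext_lt; intros i Hi.
    replace (S (m - 1 - i)) with (m - i)%nat by lia. f_equal. unfold u.
    rewrite Hs. replace (S (m - 1 - i)) with (m - i)%nat by lia.
    rewrite minus_INR by lia. rewrite !S_INR. f_equal; ring. }
  rewrite E2.
  rewrite (psum_ext (fun i => s' (INR (S i)) (INR (S m)) * l (S i)) (fun i => u i * l (S i))).
  2:{ intros i; unfold u; rewrite Hs'; auto. }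
  ring.
Qed.

(** Beyond its term with l_d alone, the antidiagonal a + b = d contributes exactly the border that
    the square gains, except for the corner; so all products of distinct l_a cancel in the
    difference. For s(a, b) = T(a, b, - a - b) and s'(a, b) = s(- a, b), the relation between s and
    s' is the evenness of T. *)
Lemma tri_sub_sq (l : nat -> R) (s s' : R -> R -> R) (N : nat) :
  l 0%nat = 0 ->
  (forall a b, (0 < a)%nat -> (0 < b)%nat -> l a * l b = l (a + b)%nat * (1 + l a + l b)) ->
  (forall x y, s x y = s y x) -> (forall x y, s' x y = s' y x) ->
  (forall x y, s x (y - x) = s' x y) ->
  tri l s N - sq l s' N =
  psum (fun d => l d * psum (fun i => s (INR (S i)) (INR d - INR (S i))) (d - 1)
                 - s' (INR d) (INR d) * l d ^ 2) N.
Proof.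
  intros L0 Ladd Hs Hs' Hss. induction N as [|N IH]; [unfold tri, sq; simpl; ring|].
  unfold tri in *. cbn [psum] in *. rewrite sq_S by auto. rewrite <- IH.
  change (psum (fun a => s (INR a) (INR (N - a)) * (l a * l (N - a)%nat)) N +
     s (INR N) (INR (N - N)) * (l N * l (N - N)%nat))
   with (psum (fun a => s (INR a) (INR (N - a)) * (l a * l (N - a)%nat)) (S N)).
  rewrite (antidiagonal_sum l s s' N) by auto. ring.
Qed.

Definition monom (c : R) (i j : nat) : R * nat * nat := (c, i, j).

Definition peval (p : list (R * nat * nat)) (x y : R) : R :=
  fold_right (fun t acc => fst (fst t) * x ^ snd (fst t) * y ^ snd t + acc) 0 p.

(** The triangular sum of a monomial tends to the product of moments, the square sum at (- x, y) to
    (-1)^i times this product; so only odd exponents of x survive. *)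
Definition pair_sum_value (p : list (R * nat * nat)) (h : R) : R :=
  fold_right (fun t acc => fst (fst t) * (1 - (-1) ^ snd (fst t))
                           * (mom (snd (fst t)) h * mom (snd t) h) + acc) 0 p.

Lemma is_lim_seq_tri_monomial (i j : nat) (h : R) :
  0 < h ->
  is_lim_seq (tri (fun a => lam a h) (fun x y => x ^ i * y ^ j)) (mom i h * mom j h).
Proof.
  intros Hh. unfold tri. apply is_series_psum.
  apply is_series_ext with
    (fun n => sum_f_R0 (fun k => (INR k ^ i * lam k h)
                                 * (INR (n - k) ^ j * lam (n - k) h)) n).
  - intros n. rewrite sum_f_R0_psum. apply psum_ext; intros; ring.
  - apply (is_series_mult_pos (fun a => INR a ^ i * lam a h) (fun a => INR a ^ j * lam a h)).
    + apply Series_correct, ex_series_mom; auto.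
    + apply Series_correct, ex_series_mom; auto.
    + intros; apply Rmult_le_pos; [apply pow_le, pos_INR | apply lam_ge_0; auto].
    + intros; apply Rmult_le_pos; [apply pow_le, pos_INR | apply lam_ge_0; auto].
Qed.

Lemma is_lim_seq_sq_monomial (i j : nat) (h : R) :
  0 < h ->
  is_lim_seq (sq (fun a => lam a h) (fun x y => x ^ i * y ^ j)) (mom i h * mom j h).
Proof.
  intros Hh.
  assert (C : forall k, is_lim_seq (psum (fun a => INR a ^ k * lam a h)) (mom k h)).
  { intros k. apply is_series_psum, Series_correct, ex_series_mom; auto. }
  apply is_lim_seq_ext with
    (fun N => psum (fun a => INR a ^ i * lam a h) N * psum (fun a => INR a ^ j * lam a h) N).
  - intros N. unfold sq. rewrite <- psum_scal. apply psum_ext; intros d.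
    rewrite (psum_ext (fun a => INR a ^ i * INR d ^ j * (lam a h * lam d h))
      (fun a => (INR d ^ j * lam d h) * (INR a ^ i * lam a h))) by (intros; ring).
    rewrite psum_scal; ring.
  - apply is_lim_seq_mult'; apply C.
Qed.

Lemma tri_linear (l : nat -> R) (c : R) (s s1 s2 : R -> R -> R) (N : nat) :
  (forall x y, s x y = c * s1 x y + s2 x y) -> tri l s N = c * tri l s1 N + tri l s2 N.
Proof.
  intros H. unfold tri. rewrite <- psum_scal, <- psum_plus. apply psum_ext; intros d.
  rewrite <- psum_scal, <- psum_plus. apply psum_ext; intros a. rewrite H; ring.
Qed.

Lemma sq_linear (l : nat -> R) (c : R) (s s1 s2 : R -> R -> R) (N : nat) :
  (forall x y, s x y = c * s1 x y + s2 x y) -> sq l s N = c * sq l s1 N + sq l s2 N.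
Proof.
  intros H. unfold sq. rewrite <- psum_scal, <- psum_plus. apply psum_ext; intros d.
  rewrite <- psum_scal, <- psum_plus. apply psum_ext; intros a. rewrite H; ring.
Qed.

Lemma is_lim_seq_pair_sum (p : list (R * nat * nat)) (h : R) :
  0 < h ->
  is_lim_seq (fun N => tri (fun a => lam a h) (peval p) N
                       - sq (fun a => lam a h) (fun x y => peval p (- x) y) N)
    (pair_sum_value p h).
Proof.
  intros Hh. induction p as [|[[c i] j] p IH].
  - apply is_lim_seq_ext with (fun _ => 0); [|apply is_lim_seq_const].
    intros N. unfold tri, sq, peval; simpl fold_right. symmetry.
    rewrite (psum_ext _ (fun _ => 0 * 0)), psum_scal.
    2:{ intros d. rewrite (psum_ext _ (fun _ => 0 * 0)), psum_scal; [ring|]. intros; ring. }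
    rewrite (psum_ext (fun d => psum _ N) (fun _ => 0 * 0)), psum_scal; [ring|].
    intros d. rewrite (psum_ext _ (fun _ => 0 * 0)), psum_scal; [ring|]. intros; ring.
  - apply is_lim_seq_ext with (fun N =>
      (c * tri (fun a => lam a h) (fun x y => x ^ i * y ^ j) N
       - c * (-1) ^ i * sq (fun a => lam a h) (fun x y => x ^ i * y ^ j) N)
      + (tri (fun a => lam a h) (peval p) N
         - sq (fun a => lam a h) (fun x y => peval p (- x) y) N)).
    + intros N.
      rewrite (tri_linear _ c (peval ((c, i, j) :: p)) (fun x y => x ^ i * y ^ j) (peval p)).
      2:{ intros; simpl; ring. }
      rewrite (sq_linear _ (c * (-1) ^ i) (fun x y => peval ((c, i, j) :: p) (- x) y)
        (fun x y => x ^ i * y ^ j) (fun x y => peval p (- x) y)).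
      2:{ intros; simpl. replace (- x) with (-1 * x) by ring. rewrite Rpow_mult_distr; ring. }
      ring.
    + change (pair_sum_value ((c, i, j) :: p) h) with
        (c * (1 - (-1) ^ i) * (mom i h * mom j h) + pair_sum_value p h).
      apply is_lim_seq_plus'; [|exact IH].
      replace (c * (1 - (-1) ^ i) * (mom i h * mom j h)) with
        (c * (mom i h * mom j h) - c * (-1) ^ i * (mom i h * mom j h)) by ring.
      apply is_lim_seq_minus';
        apply (is_lim_seq_scal_l _ _ (Finite (mom i h * mom j h))).
      * apply is_lim_seq_tri_monomial; auto.
      * apply is_lim_seq_sq_monomial; auto.
Qed.

Lemma lam_mult (a b : nat) (h : R) :
  0 < h -> (0 < a)%nat -> (0 < b)%nat ->
  lam a h * lam b h = lam (a + b) h * (1 + lam a h + lam b h).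
Proof.
  intros Hh Ha Hb. unfold lam.
  assert (H1 := exp_INR_mul_gt_1 a h Ha Hh).
  assert (H2 := exp_INR_mul_gt_1 b h Hb Hh).
  rewrite plus_INR, Rmult_plus_distr_r, exp_plus.
  field. repeat split; nra.
Qed.

(** The limit of [tri_sub_sq]: it expresses [mom2 e] by products of moments and by single moments.
    The hypotheses on [p] are the symmetries of T and its value on the diagonal of the square;
    [poly] is the sum of T over an antidiagonal. *)
Lemma pair_sum_identity (p : list (R * nat * nat)) (poly : R -> R) (e : nat) (c h v : R) :
  0 < h ->
  (forall x y, peval p x y = peval p y x) ->
  (forall x y, peval p (- x) y = peval p (- y) x) ->
  (forall x y, peval p x (y - x) = peval p (- x) y) ->
  (forall x, peval p (- x) x = c * x ^ e) ->
  (forall d, (0 < d)%nat ->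
     psum (fun i => peval p (INR (S i)) (INR d - INR (S i))) (d - 1) = poly (INR d)) ->
  is_series (fun d => lam d h * poly (INR d)) v ->
  pair_sum_value p h = v - c * mom2 e h.
Proof.
  intros Hh H1 H2 H3 H4 H5 H6.
  assert (L := is_lim_seq_pair_sum p h Hh).
  assert (S2 : is_series (fun d => c * (INR d ^ e * lam d h ^ 2)) (c * mom2 e h)).
  { apply (is_series_scal_l (V := R_NormedModule)).
    apply Series_correct, ex_series_mom2; auto. }
  assert (S3 := is_series_minus _ _ _ _ H6 S2).
  apply is_series_psum in S3.
  assert (U1 := is_lim_seq_unique _ _ S3).
  rewrite (is_lim_seq_unique _ (pair_sum_value p h)) in U1.
  - injection U1 as E; rewrite E; reflexivity.
  - apply is_lim_seq_ext with (2 := L).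
    intros N. rewrite (tri_sub_sq (fun a => lam a h) (peval p) (fun x y => peval p (- x) y)).
    + apply psum_ext; intros d. destruct d as [|d].
      * rewrite lam_0, H4. unfold minus, plus, opp; simpl. ring.
      * rewrite H5, H4 by lia. unfold minus, plus, opp; simpl. ring.
    + apply lam_0.
    + intros; apply lam_mult; auto.
    + exact H1.
    + exact H2.
    + exact H3.
Qed.

Lemma is_series_mom_scal (c : R) (i : nat) (h : R) :
  0 < h -> is_series (fun d => c * (INR d ^ i * lam d h)) (c * mom i h).
Proof.
  intros Hh. apply (is_series_scal_l (V := R_NormedModule)).
  apply Series_correct, ex_series_mom; auto.
Qed.

(** The form is a^2 + ab + b^2, up to scaling the only symmetric form of degree 2 in a, b, - a - b.
    The antidiagonal sum leaves out both end points, whence a term - d^2: its [mom 2] joins [mom2 2]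
    into the derivative of [mom 1]. *)
Lemma mom2_2 (h : R) : 0 < h ->
  2 * mom 1 h ^ 2 = 5 / 6 * mom 3 h + (-1 * mom 2 h + 1 / 6 * mom 1 h) - 1 * mom2 2 h.
Proof.
  intros Hh.
  rewrite <- (pair_sum_identity (monom 1 2 0 :: monom 1 1 1 :: monom 1 0 2 :: nil)
    (fun d => 5 / 6 * d ^ 3 - d ^ 2 + 1 / 6 * d) 2 1 h); auto.
  - unfold pair_sum_value; simpl; ring.
  - intros; simpl; ring.
  - intros; simpl; ring.
  - intros; simpl; ring.
  - intros; simpl; ring.
  - intros d Hd.
    (* The number of terms and [x] are kept independent, so that the induction on [n] closes;
       afterwards n = d - 1 and x = d. *)
    assert (G : forall x n, psum (fun i => peval (monom 1 2 0 :: monom 1 1 1 :: monom 1 0 2 :: nil)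
        (INR (S i)) (x - INR (S i))) n =
      (fun n => (1/6)*n + (-1/2)*n*x + n*x^2 + (1/2)*n^2 + (-1/2)*n^2*x + (1/3)*n^3) (INR n)).
    { intros x n; induction n as [|n IH]; [simpl; ring|].
      cbn [psum]; rewrite IH, S_INR; simpl; field. }
    rewrite G, minus_INR by lia. simpl; field.
  - eapply is_series_ext.
    2:{ apply (is_series_plus (V := R_NormedModule));
          [|apply (is_series_plus (V := R_NormedModule))]; apply is_series_mom_scal; auto. }
    intros d; unfold plus; simpl; field.
Qed.

(** The form is (a^2 + ab + b^2)^2, again the only one of its degree up to scaling. *)
Lemma mom2_4 (h : R) : 0 < h ->
  8 * mom 1 h * mom 3 h = 7 / 10 * mom 5 h + (-1 * mom 4 h + (1 / 3 * mom 3 h + - 1 / 30 * mom 1 h))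
                          - 1 * mom2 4 h.
Proof.
  intros Hh.
  pose (p := (monom 1 4 0 :: monom 2 3 1 :: monom 3 2 2 :: monom 2 1 3 :: monom 1 0 4 :: nil)
    : list (R * nat * nat)).
  rewrite <- (pair_sum_identity p
    (fun d => 7 / 10 * d ^ 5 - d ^ 4 + 1 / 3 * d ^ 3 - 1 / 30 * d) 4 1 h); auto.
  - unfold pair_sum_value; simpl; ring.
  - intros; simpl; ring.
  - intros; simpl; ring.
  - intros; simpl; ring.
  - intros; simpl; ring.
  - intros d Hd.
    assert (G : forall x n, psum (fun i => peval p (INR (S i)) (x - INR (S i))) n =
      (fun n => (-1/30)*n^1*x^0 + (1/2)*n^1*x^2 + (-1/1)*n^1*x^3 + (1/1)*n^1*x^4
        + (-1/2)*n^2*x^1 + (3/2)*n^2*x^2 + (-1/1)*n^2*x^3 + (1/3)*n^3*x^0 + (-1/1)*n^3*x^1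
        + (1/1)*n^3*x^2 + (1/2)*n^4*x^0 + (-1/2)*n^4*x^1 + (1/5)*n^5*x^0) (INR n)).
    { intros x n; induction n as [|n IH]; [simpl; field|].
      cbn [psum]; rewrite IH, S_INR; simpl; field. }
    rewrite G, minus_INR by lia. simpl; field.
  - eapply is_series_ext.
    2:{ do 3 (apply (is_series_plus (V := R_NormedModule)); [apply is_series_mom_scal; auto|]).
        apply is_series_mom_scal; auto. }
    intros d; unfold plus; simpl; field.
Qed.

(* The form is (a^2+ab+b^2)^3 - 249/14 (ab(a+b))^2: the second coefficient is the one
   that cancels the seventh powers in the divisor sum. *)
Lemma mom2_6 (h : R) : 0 < h ->
  12 * mom 1 h * mom 5 h - 400 / 7 * mom 3 h ^ 2
  = -1 * mom 6 h + (1 / 2 * mom 5 h + (10 / 21 * mom 3 h + 1 / 42 * mom 1 h)) - 1 * mom2 6 h.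
Proof.
  intros Hh.
  pose (p := (monom 1 6 0 :: monom 3 5 1 :: monom (- 165 / 14) 4 2 :: monom (- 200 / 7) 3 3
    :: monom (- 165 / 14) 2 4 :: monom 3 1 5 :: monom 1 0 6 :: nil) : list (R * nat * nat)).
  rewrite <- (pair_sum_identity p
    (fun d => - d ^ 6 + 1 / 2 * d ^ 5 + 10 / 21 * d ^ 3 + 1 / 42 * d) 6 1 h); auto.
  - unfold pair_sum_value; simpl; field.
  - intros; simpl; ring.
  - intros; simpl; ring.
  - intros; simpl; field.
  - intros; simpl; field.
  - intros d Hd.
    assert (G : forall x n, psum (fun i => peval p (INR (S i)) (x - INR (S i))) n =
      (fun n => (1/42)*n^1*x^0 + (-1/5)*n^1*x^2 + (1/1)*n^1*x^4 + (-3/2)*n^1*x^5 + (1/1)*n^1*x^6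
        + (1/4)*n^2*x^1 + (-7/4)*n^2*x^3 + (3/1)*n^2*x^4 + (-3/2)*n^2*x^5 + (-1/6)*n^3*x^0
        + (2/1)*n^3*x^2 + (-7/2)*n^3*x^3 + (2/1)*n^3*x^4 + (-5/4)*n^4*x^1 + (3/1)*n^4*x^2
        + (-7/4)*n^4*x^3 + (1/2)*n^5*x^0 + (-3/2)*n^5*x^1 + (6/5)*n^5*x^2 + (1/2)*n^6*x^0
        + (-1/2)*n^6*x^1 + (1/7)*n^7*x^0
        - 249 / 14 * ((-1/30)*n^1*x^2 + (1/6)*n^1*x^4 + (-1/2)*n^2*x^3 + (1/2)*n^2*x^4
        + (1/3)*n^3*x^2 + (-1/1)*n^3*x^3 + (1/3)*n^3*x^4 + (1/2)*n^4*x^2 + (-1/2)*n^4*x^3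
        + (1/5)*n^5*x^2)) (INR n)).
    { intros x n; induction n as [|n IH]; [simpl; field|].
      cbn [psum]; rewrite IH, S_INR; simpl; field. }
    rewrite G, minus_INR by lia. simpl; field.
  - eapply is_series_ext.
    2:{ do 3 (apply (is_series_plus (V := R_NormedModule)); [apply is_series_mom_scal; auto|]).
        apply is_series_mom_scal; auto. }
    intros d; unfold plus; simpl; field.
Qed.

Definition eisP (h : R) : R := 1 - 24 * mom 1 h.
Definition eisQ (h : R) : R := 1 + 240 * mom 3 h.
Definition eisR (h : R) : R := 1 - 504 * mom 5 h.

Lemma is_derive_affine_mom (u c : R) (i : nat) (h l : R) :
  0 < h -> l = - c * (mom (S i) h + mom2 (S i) h) ->
  is_derive (fun t => u + c * mom i t) h l.
Proof.
  intros Hh ->. assert (D := is_derive_mom i h Hh).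
  replace (- c * (mom (S i) h + mom2 (S i) h)) with
    (plus 0 (c * - (mom (S i) h + mom2 (S i) h))) by (unfold plus; simpl; ring).
  apply (is_derive_plus (K := R_AbsRing) (V := R_NormedModule) (fun _ => u)).
  - apply (is_derive_const (K := R_AbsRing) (V := R_NormedModule)).
  - apply (is_derive_scal (mom i)); exact D.
Qed.

(** With q = e^(-h) the operator q d/dq is - d/dh, so this is q dP/dq = (P^2 - Q)/12. The moment
    [mom 2] cancels between the derivative of [mom 1] and the value of [mom2 2]. *)
Lemma is_derive_eisP (h : R) : 0 < h -> is_derive eisP h (- (eisP h ^ 2 - eisQ h) / 12).
Proof.
  intros Hh. apply is_derive_ext with (fun t => 1 + -24 * mom 1 t).
  { intros t; unfold eisP; simpl; ring. }
  apply is_derive_affine_mom; auto. assert (E := mom2_2 h Hh).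
  unfold eisP, eisQ. replace (mom2 2 h) with
    (5 / 6 * mom 3 h + (-1 * mom 2 h + 1 / 6 * mom 1 h) - 2 * mom 1 h ^ 2) by lra. field.
Qed.

Lemma is_derive_eisQ (h : R) : 0 < h -> is_derive eisQ h (- (eisP h * eisQ h - eisR h) / 3).
Proof.
  intros Hh. apply is_derive_affine_mom; auto. assert (E := mom2_4 h Hh).
  unfold eisP, eisQ, eisR. replace (mom2 4 h) with
    (7 / 10 * mom 5 h + (-1 * mom 4 h + (1 / 3 * mom 3 h + - 1 / 30 * mom 1 h))
     - 8 * mom 1 h * mom 3 h) by lra. field.
Qed.

Lemma is_derive_eisR (h : R) :
  0 < h -> is_derive eisR h (- (eisP h * eisR h - eisQ h ^ 2) / 2).
Proof.
  intros Hh. apply is_derive_ext with (fun t => 1 + -504 * mom 5 t).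
  { intros t; unfold eisR; simpl; ring. }
  apply is_derive_affine_mom; auto. assert (E := mom2_6 h Hh).
  unfold eisP, eisQ, eisR. replace (mom2 6 h) with
    (-1 * mom 6 h + (1 / 2 * mom 5 h + (10 / 21 * mom 3 h + 1 / 42 * mom 1 h))
     - (12 * mom 1 h * mom 5 h - 400 / 7 * mom 3 h ^ 2)) by lra. field.
Qed.

(** * Row sums *)

(* With [s = p + i q], these are the real parts of [1/s], [1/s^2], [1/s^3]. *)
Definition r2 (p q : R) : R := p / (p ^ 2 + q ^ 2).
Definition r4 (p q : R) : R := (p ^ 2 - q ^ 2) / (p ^ 2 + q ^ 2) ^ 2.
Definition r6 (p q : R) : R := (p ^ 3 - 3 * p * q ^ 2) / (p ^ 2 + q ^ 2) ^ 3.

(* Real and imaginary part, and modulus, of [sin (x + i y) ^ 2]. *)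
Definition sre (x y : R) : R := sin x ^ 2 * cosh y ^ 2 - cos x ^ 2 * sinh y ^ 2.
Definition sim (x y : R) : R := 2 * (sin x * cos x) * (sinh y * cosh y).
Definition smod (x y : R) : R := sin x ^ 2 + sinh y ^ 2.

(** Differentiating sum 1/(z + n pi)^2 = 1/sin^2 z twice gives sum 1/(z + n pi)^4 = 1/sin^4 z -
    (2/3)/sin^2 z, and four times the analogue with exponent 6. [f4] and [f6] are the real parts of
    these closed forms at z = x + i y. *)
Definition f4 (x y : R) : R := r4 (sre x y) (sim x y) - 2 / 3 * r2 (sre x y) (sim x y).
Definition f6 (x y : R) : R :=
  r6 (sre x y) (sim x y) - r4 (sre x y) (sim x y) + 2 / 15 * r2 (sre x y) (sim x y).

(* Real parts of [1/(x + i y)^4] and [1/(x + i y)^6]. *)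
Definition c4 (x y : R) : R := r4 (x ^ 2 - y ^ 2) (2 * x * y).
Definition c6 (x y : R) : R := r6 (x ^ 2 - y ^ 2) (2 * x * y).

Lemma cos_sq_sin (x : R) : cos x ^ 2 = 1 - sin x ^ 2.
Proof. assert (H := sin2_cos2 x). unfold Rsqr in H. simpl; lra. Qed.

Lemma cosh_sq_sinh (y : R) : cosh y ^ 2 = 1 + sinh y ^ 2.
Proof.
  unfold cosh, sinh. assert (H : exp y * exp (- y) = 1).
  { rewrite <- exp_plus, Rplus_opp_r; apply exp_0. }
  replace (((exp y + exp (- y)) / 2) ^ 2)
    with (((exp y - exp (- y)) / 2) ^ 2 + exp y * exp (- y)) by field. lra.
Qed.

Lemma sinh_2 (y : R) : sinh (2 * y) = 2 * (sinh y * cosh y).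
Proof.
  unfold cosh, sinh. replace (2 * y) with (y + y) by ring.
  replace (- (y + y)) with (- y + - y) by ring. rewrite !exp_plus. field.
Qed.

Lemma cosh_2 (y : R) : cosh (2 * y) = 1 + 2 * sinh y ^ 2.
Proof.
  assert (H := cosh_sq_sinh y). revert H. unfold cosh, sinh.
  replace (2 * y) with (y + y) by ring.
  replace (- (y + y)) with (- y + - y) by ring. rewrite !exp_plus. simpl. lra.
Qed.

Lemma sre_sim_sq (x y : R) : sre x y ^ 2 + sim x y ^ 2 = smod x y ^ 2.
Proof.
  unfold sre, sim, smod.
  replace ((2 * (sin x * cos x) * (sinh y * cosh y)) ^ 2) with
    (4 * sin x ^ 2 * cos x ^ 2 * sinh y ^ 2 * cosh y ^ 2) by ring.
  rewrite cosh_sq_sinh, cos_sq_sin. ring.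
Qed.

(** With s = sin^2 z one has sin^2 (2z) = 4 s (1 - s), and sin^2 (z + pi/2) = 1 - s. So duplication
    and shift act polynomially on the pair of [sre] and [sim]. *)
Lemma sre_double (x y : R) :
  sre (2 * x) (2 * y) = 4 * (sre x y - sre x y ^ 2 + sim x y ^ 2).
Proof.
  unfold sre, sim. rewrite sin_2a, cos_2a_sin, sinh_2, cosh_2.
  replace ((2 * (sin x * cos x) * (sinh y * cosh y)) ^ 2) with
    (4 * sin x ^ 2 * cos x ^ 2 * sinh y ^ 2 * cosh y ^ 2) by ring.
  replace ((2 * sin x * cos x) ^ 2) with (4 * sin x ^ 2 * cos x ^ 2) by ring.
  replace ((2 * (sinh y * cosh y)) ^ 2) with (4 * sinh y ^ 2 * cosh y ^ 2) by ring.
  rewrite cosh_sq_sinh, cos_sq_sin. ring.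
Qed.

Lemma sim_double (x y : R) :
  sim (2 * x) (2 * y) = 4 * (sim x y - 2 * sre x y * sim x y).
Proof.
  unfold sre, sim. rewrite sin_2a, cos_2a_sin, sinh_2, cosh_2.
  rewrite cosh_sq_sinh, cos_sq_sin. ring.
Qed.

Lemma sre_shift (x y : R) : sre (x + PI / 2) y = 1 - sre x y.
Proof.
  unfold sre. replace (x + PI / 2) with (PI / 2 + x) by ring.
  rewrite <- cos_sin, cos_plus, cos_PI2, sin_PI2.
  replace (0 * cos x - 1 * sin x) with (- sin x) by ring.
  replace ((- sin x) ^ 2) with (sin x ^ 2) by ring.
  rewrite cosh_sq_sinh, cos_sq_sin. ring.
Qed.

Lemma sim_shift (x y : R) : sim (x + PI / 2) y = - sim x y.
Proof.
  unfold sim. replace (x + PI / 2) with (PI / 2 + x) by ring.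
  rewrite <- cos_sin, cos_plus, cos_PI2, sin_PI2. ring.
Qed.

Lemma smod_double (x y : R) :
  smod (2 * x) (2 * y) ^ 2 = 16 * smod x y ^ 2 * smod (x + PI / 2) y ^ 2.
Proof.
  rewrite <- !sre_sim_sq, sre_double, sim_double, sre_shift, sim_shift. ring.
Qed.

Lemma smod_double_neq_0 (x y : R) :
  smod (2 * x) (2 * y) <> 0 -> smod x y <> 0 /\ smod (x + PI / 2) y <> 0.
Proof.
  intros H; split; intros E; apply H;
    assert (D := smod_double x y); rewrite E in D; nra.
Qed.

(** In terms of s = sin^2 z this is a rational identity between the values at 4 s (1 - s), s and 1 -
    s; the trigonometry disappears and [field] decides it. *)
Lemma f4_double (x y : R) :
  smod (2 * x) (2 * y) <> 0 -> f4 (2 * x) (2 * y) = (/ 2) ^ 4 * (f4 x y + f4 (x + PI / 2) y).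
Proof.
  intros H. apply smod_double_neq_0 in H. destruct H as [H1 H2].
  assert (N1 : smod x y ^ 2 <> 0) by (apply pow_nonzero; auto).
  assert (N2 : smod (x + PI / 2) y ^ 2 <> 0) by (apply pow_nonzero; auto).
  rewrite <- sre_sim_sq in N1, N2. rewrite sre_shift, sim_shift in N2.
  unfold f4, r4, r2. rewrite sre_double, sim_double, sre_shift, sim_shift.
  revert N1 N2. generalize (sre x y), (sim x y). intros p q N1 N2.
  field. repeat split; auto.
  replace ((4 * (p - p ^ 2 + q ^ 2)) ^ 2 + (4 * (q - 2 * p * q)) ^ 2)
    with (16 * ((p ^ 2 + q ^ 2) * ((1 - p) ^ 2 + (- q) ^ 2))) by ring.
  apply Rmult_integral_contrapositive_currified; [lra|].
  apply Rmult_integral_contrapositive_currified; auto.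
Qed.

Lemma f6_double (x y : R) :
  smod (2 * x) (2 * y) <> 0 -> f6 (2 * x) (2 * y) = (/ 2) ^ 6 * (f6 x y + f6 (x + PI / 2) y).
Proof.
  intros H. apply smod_double_neq_0 in H. destruct H as [H1 H2].
  assert (N1 : smod x y ^ 2 <> 0) by (apply pow_nonzero; auto).
  assert (N2 : smod (x + PI / 2) y ^ 2 <> 0) by (apply pow_nonzero; auto).
  rewrite <- sre_sim_sq in N1, N2. rewrite sre_shift, sim_shift in N2.
  unfold f6, r6, r4, r2. rewrite sre_double, sim_double, sre_shift, sim_shift.
  revert N1 N2. generalize (sre x y), (sim x y). intros p q N1 N2.
  field. repeat split; auto.
  replace ((4 * (p - p ^ 2 + q ^ 2)) ^ 2 + (4 * (q - 2 * p * q)) ^ 2)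
    with (16 * ((p ^ 2 + q ^ 2) * ((1 - p) ^ 2 + (- q) ^ 2))) by ring.
  apply Rmult_integral_contrapositive_currified; [lra|].
  apply Rmult_integral_contrapositive_currified; auto.
Qed.

Lemma Rabs_le_of_sq (x y : R) : 0 <= y -> x ^ 2 <= y ^ 2 -> Rabs x <= y.
Proof.
  intros Hy H. rewrite <- (Rabs_pos_eq y Hy). apply Rsqr_le_abs_0.
  unfold Rsqr; simpl in H; lra.
Qed.

Lemma Rabs_quotient_le (n D : R) (k : nat) :
  0 < D -> Rabs n <= D ^ k -> Rabs (n / (D ^ 2) ^ k) <= (/ D) ^ k.
Proof.
  intros HD H. assert (HDk : 0 < D ^ k) by (apply pow_lt; auto).
  unfold Rdiv. rewrite Rabs_mult, (Rabs_pos_eq (/ (D ^ 2) ^ k)).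
  2:{ left. apply Rinv_0_lt_compat. apply pow_lt, pow_lt; auto. }
  rewrite pow_inv. replace ((D ^ 2) ^ k) with (D ^ k * D ^ k) by (rewrite <- Rpow_mult_distr; f_equal; ring).
  rewrite Rinv_mult, <- Rmult_assoc.
  rewrite <- (Rmult_1_l (/ D ^ k)) at 3.
  apply Rmult_le_compat_r; [left; apply Rinv_0_lt_compat; auto|].
  apply Rmult_le_reg_r with (D ^ k); auto. rewrite Rmult_assoc, Rinv_l; lra.
Qed.

Lemma r2_bound (p q D : R) : 0 < D -> p ^ 2 + q ^ 2 = D ^ 2 -> Rabs (r2 p q) <= / D.
Proof.
  intros HD E. unfold r2. rewrite E.
  assert (H := Rabs_quotient_le p D 1 HD). rewrite !pow_1 in H. apply H.
  apply Rabs_le_of_sq; [lra|]. assert (0 <= q ^ 2) by apply pow2_ge_0. lra.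
Qed.

Lemma r4_bound (p q D : R) : 0 < D -> p ^ 2 + q ^ 2 = D ^ 2 -> Rabs (r4 p q) <= (/ D) ^ 2.
Proof.
  intros HD E. unfold r4. rewrite E. apply Rabs_quotient_le; auto.
  assert (0 <= q ^ 2) by apply pow2_ge_0. assert (0 <= p ^ 2) by apply pow2_ge_0.
  apply Rabs_le; lra.
Qed.

Lemma r6_bound (p q D : R) : 0 < D -> p ^ 2 + q ^ 2 = D ^ 2 -> Rabs (r6 p q) <= (/ D) ^ 3.
Proof.
  intros HD E. unfold r6. rewrite E. apply Rabs_quotient_le; auto.
  apply Rabs_le_of_sq; [apply pow_le; lra|].
  replace ((D ^ 3) ^ 2) with ((D ^ 2) ^ 3) by ring. rewrite <- E.
  assert (0 <= (3 * p ^ 2 * q - q ^ 3) ^ 2) by apply pow2_ge_0.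
  replace ((p ^ 2 + q ^ 2) ^ 3) with
    ((p ^ 3 - 3 * p * q ^ 2) ^ 2 + (3 * p ^ 2 * q - q ^ 3) ^ 2) by ring. lra.
Qed.

Lemma cosh_ge_1 (y : R) : 1 <= cosh y.
Proof.
  assert (H := cosh_sq_sinh y). assert (0 <= sinh y ^ 2) by apply pow2_ge_0.
  assert (0 < cosh y).
  { unfold cosh. assert (0 < exp y) by apply exp_pos. assert (0 < exp (- y)) by apply exp_pos. lra. }
  nra.
Qed.

Lemma sinh_sq_ge (y : R) : y ^ 2 <= sinh y ^ 2.
Proof.
  destruct (MVT_gen sinh 0 y cosh) as [c [_ E]].
  - intros x _. apply is_derive_Reals, derivable_pt_lim_sinh.
  - intros x _. apply derivable_continuous_pt. exists (cosh x). apply derivable_pt_lim_sinh.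
  - rewrite sinh_0 in E. replace (sinh y) with (cosh c * y) by lra.
    rewrite Rpow_mult_distr. assert (H := cosh_ge_1 c).
    rewrite <- (Rmult_1_l (y ^ 2)) at 1.
    apply Rmult_le_compat_r; [apply pow2_ge_0 | nra].
Qed.

(** From sin t >= t - t^3/6 and t^2 <= 4, as pi/2 <= 2. *)
Lemma sin_sq_ge (x : R) : Rabs x <= PI / 2 -> x ^ 2 / 9 <= sin x ^ 2.
Proof.
  assert (HP := PI_4). assert (HP0 := PI_RGT_0).
  assert (G : forall t, 0 <= t <= PI / 2 -> t ^ 2 / 9 <= sin t ^ 2).
  { intros t Ht. assert (H : t / 3 <= sin t).
    { destruct (sin_bound t 0) as [H _]; [lra|lra|].
      unfold sin_approx, sin_term in H; simpl in H.
      assert (t - t * (t * t) / 6 <= sin t) by lra.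
      assert (t * (t * t) <= t * 4) by (apply Rmult_le_compat_l; nra). lra. }
    nra. }
  intros H. destruct (Rle_dec 0 x).
  - apply G. rewrite Rabs_pos_eq in H; lra.
  - replace (x ^ 2) with ((- x) ^ 2) by ring.
    replace (sin x ^ 2) with (sin (- x) ^ 2) by (rewrite sin_neg; ring).
    apply G. rewrite Rabs_left in H; lra.
Qed.

Lemma smod_lower (e x y : R) :
  Rabs (e * x) <= PI / 2 -> e ^ 2 * ((x ^ 2 + y ^ 2) / 9) <= smod (e * x) (e * y).
Proof.
  intros H. unfold smod. assert (H1 := sin_sq_ge _ H). assert (H2 := sinh_sq_ge (e * y)).
  rewrite Rpow_mult_distr in H1, H2. assert (0 <= e ^ 2 * y ^ 2).
  { apply Rmult_le_pos; apply pow2_ge_0. } lra.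
Qed.

(** B majorizes e^2/|sin (e z)|^2 when e |x| <= pi/2. For e <= 1 its three powers cover the three
    terms of e^6 [f6] and the two terms of e^4 [f4]. *)
Definition row_bound (x y : R) : R :=
  let B := 9 / (x ^ 2 + y ^ 2) in B + B ^ 2 + B ^ 3.

Lemma f_bounds (e x y : R) :
  0 < e <= 1 -> 0 < x ^ 2 + y ^ 2 -> Rabs (e * x) <= PI / 2 ->
  Rabs (e ^ 4 * f4 (e * x) (e * y)) <= row_bound x y /\
  Rabs (e ^ 6 * f6 (e * x) (e * y)) <= row_bound x y.
Proof.
  intros He Hxy Hx. unfold row_bound.
  set (B := 9 / (x ^ 2 + y ^ 2)). set (D := smod (e * x) (e * y)).
  assert (HD : e ^ 2 * ((x ^ 2 + y ^ 2) / 9) <= D) by (apply smod_lower; auto).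
  assert (e2 : 0 < e ^ 2 <= 1) by nra.
  assert (HB : 0 < B) by (apply Rdiv_lt_0_compat; lra).
  assert (HD0 : 0 < D) by (eapply Rlt_le_trans; [|exact HD]; apply Rmult_lt_0_compat; lra).
  assert (E := sre_sim_sq (e * x) (e * y)). fold D in E.
  assert (B2 := r2_bound _ _ _ HD0 E). assert (B4 := r4_bound _ _ _ HD0 E).
  assert (B6 := r6_bound _ _ _ HD0 E).
  assert (HV : 0 < e ^ 2 * / D <= B).
  { split; [apply Rmult_lt_0_compat; [lra | apply Rinv_0_lt_compat; auto]|].
    unfold B. apply Rmult_le_reg_r with D; auto. rewrite Rmult_assoc, Rinv_l by lra.
    apply Rmult_le_reg_l with ((x ^ 2 + y ^ 2) / 9); [lra|].
    replace ((x ^ 2 + y ^ 2) / 9 * (9 / (x ^ 2 + y ^ 2) * D)) with D by (field; lra). lra. }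
  set (V := e ^ 2 * / D) in *.
  assert (HV2 : V ^ 2 <= B ^ 2) by (apply pow_incr; lra).
  assert (HV3 : V ^ 3 <= B ^ 3) by (apply pow_incr; lra).
  assert (B30 : 0 < B ^ 3) by (apply pow_lt; auto).
  assert (V20 : 0 < V ^ 2) by (apply pow_lt; lra).
  assert (e4 : 0 < e ^ 4 <= 1) by (replace (e ^ 4) with (e ^ 2 * e ^ 2) by ring; nra).
  unfold f4, f6.
  set (t2 := r2 _ _) in *. set (t4 := r4 _ _) in *. set (t6 := r6 _ _) in *.
  assert (K2 : Rabs (e ^ 2 * t2) <= V).
  { rewrite Rabs_mult, (Rabs_pos_eq (e ^ 2)) by lra. apply Rmult_le_compat_l; lra. }
  assert (K4 : Rabs (e ^ 4 * t4) <= V ^ 2).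
  { rewrite Rabs_mult, (Rabs_pos_eq (e ^ 4)) by lra.
    replace (V ^ 2) with (e ^ 4 * (/ D) ^ 2) by (unfold V; ring).
    apply Rmult_le_compat_l; lra. }
  assert (K6 : Rabs (e ^ 6 * t6) <= V ^ 3).
  { assert (0 < e ^ 6) by (apply pow_lt; lra).
    rewrite Rabs_mult, (Rabs_pos_eq (e ^ 6)) by lra.
    replace (V ^ 3) with (e ^ 6 * (/ D) ^ 3) by (unfold V; ring).
    apply Rmult_le_compat_l; lra. }
  apply Rabs_le_between in K2. apply Rabs_le_between in K4. apply Rabs_le_between in K6.
  split; apply Rabs_le.
  - replace (e ^ 4 * (t4 - 2 / 3 * t2)) with (e ^ 4 * t4 - 2 / 3 * (e ^ 2 * (e ^ 2 * t2))) by ring.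
    assert (- V <= e ^ 2 * (e ^ 2 * t2) <= V) by nra. lra.
  - replace (e ^ 6 * (t6 - t4 + 2 / 15 * t2)) with
      (e ^ 6 * t6 - e ^ 2 * (e ^ 4 * t4) + 2 / 15 * (e ^ 4 * (e ^ 2 * t2))) by ring.
    assert (- V <= e ^ 4 * (e ^ 2 * t2) <= V) by nra.
    assert (- V ^ 2 <= e ^ 2 * (e ^ 4 * t4) <= V ^ 2) by nra. lra.
Qed.

Lemma is_lim_seq_pow (u : nat -> R) (l : R) (k : nat) :
  is_lim_seq u l -> is_lim_seq (fun n => u n ^ k) (l ^ k).
Proof.
  intros H; induction k as [|k IH]; simpl; [apply is_lim_seq_const|].
  apply is_lim_seq_mult'; auto.
Qed.

Lemma is_lim_seq_slope (g : R -> R) (l : R) (u : nat -> R) :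
  g 0 = 0 -> is_derive g 0 l -> is_lim_seq u 0 -> (forall n, u n <> 0) ->
  is_lim_seq (fun n => g (u n) / u n) l.
Proof.
  intros G0 D Hu Hn. apply is_derive_Reals in D. apply is_lim_seq_spec.
  intros eps. destruct (D eps (cond_pos eps)) as [del Hdel].
  apply is_lim_seq_spec in Hu. destruct (Hu del) as [N HN]. exists N; intros n Hle.
  specialize (HN n Hle). rewrite Rminus_0_r in HN.
  specialize (Hdel (u n) (Hn n) HN). rewrite Rplus_0_l, G0, Rminus_0_r in Hdel. exact Hdel.
Qed.

(** The exponent is [S j] because j + 1 halvings of a row produce 2^(j+1) points, grouped into 2^j
    pairs. *)
Definition half_pow (j : nat) : R := / 2 ^ S j.

Lemma half_pow_bounds (j : nat) : 0 < half_pow j <= 1.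
Proof.
  unfold half_pow. assert (H : 1 <= 2 ^ S j) by (apply pow_R1_Rle; lra).
  split; [apply Rinv_0_lt_compat; lra|].
  rewrite <- Rinv_1. apply Rinv_le_contravar; lra.
Qed.

Lemma is_lim_seq_half_pow : is_lim_seq half_pow 0.
Proof.
  assert (H := is_lim_seq_geom (/ 2) ltac:(rewrite Rabs_pos_eq; lra)).
  apply is_lim_seq_incr_1 in H. apply is_lim_seq_ext with (2 := H).
  intros n; unfold half_pow. apply pow_inv.
Qed.

Lemma is_lim_seq_trig_scaled (x y : R) :
  let e := half_pow in
  is_lim_seq (fun j => sre (e j * x) (e j * y) / e j ^ 2) (x ^ 2 - y ^ 2) /\
  is_lim_seq (fun j => sim (e j * x) (e j * y) / e j ^ 2) (2 * x * y).
Proof.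
  intros e. assert (He : is_lim_seq e 0) by apply is_lim_seq_half_pow.
  assert (Hn : forall j, e j <> 0) by (intros j; assert (H := half_pow_bounds j); unfold e; lra).
  assert (S1 : is_lim_seq (fun j => sin (e j * x) / e j) x).
  { apply (is_lim_seq_slope (fun t => sin (t * x))); auto.
    - rewrite Rmult_0_l; apply sin_0.
    - auto_derive; auto. rewrite Rmult_0_l, cos_0; ring. }
  assert (S2 : is_lim_seq (fun j => sinh (e j * y) / e j) y).
  { apply (is_lim_seq_slope (fun t => sinh (t * y))); auto.
    - rewrite Rmult_0_l; apply sinh_0.
    - unfold sinh. auto_derive; auto. rewrite Rmult_0_l, Ropp_0, exp_0; field. }
  assert (Hc : forall z, is_lim_seq (fun j => e j * z) 0).
  { intros z. replace (Finite 0) with (Finite (0 * z)) by (f_equal; ring).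
    apply is_lim_seq_mult'; auto; apply is_lim_seq_const. }
  assert (C1 : is_lim_seq (fun j => cos (e j * x)) 1).
  { rewrite <- cos_0. apply is_lim_seq_continuous; auto. apply continuity_cos. }
  assert (C2 : is_lim_seq (fun j => cosh (e j * y)) 1).
  { rewrite <- cosh_0. apply is_lim_seq_continuous; auto.
    apply derivable_continuous_pt. exists (sinh 0). apply derivable_pt_lim_cosh. }
  split.
  - apply is_lim_seq_ext with (fun j =>
      (sin (e j * x) / e j) ^ 2 * cosh (e j * y) ^ 2
      - cos (e j * x) ^ 2 * (sinh (e j * y) / e j) ^ 2).
    { intros j; unfold sre; field; auto. }
    replace (x ^ 2 - y ^ 2) with (x ^ 2 * 1 ^ 2 - 1 ^ 2 * y ^ 2) by ring.
    apply is_lim_seq_minus'; apply is_lim_seq_mult'; apply is_lim_seq_pow; auto.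
  - apply is_lim_seq_ext with (fun j =>
      2 * ((sin (e j * x) / e j) * cos (e j * x))
      * ((sinh (e j * y) / e j) * cosh (e j * y))).
    { intros j; unfold sim; field; auto. }
    replace (2 * x * y) with (2 * (x * 1) * (y * 1)) by ring.
    repeat apply is_lim_seq_mult'; auto. apply is_lim_seq_const.
Qed.

Lemma r_limits (p q : nat -> R) (lp lq : R) :
  is_lim_seq p lp -> is_lim_seq q lq -> lp ^ 2 + lq ^ 2 <> 0 ->
  is_lim_seq (fun j => r2 (p j) (q j)) (r2 lp lq) /\
  is_lim_seq (fun j => r4 (p j) (q j)) (r4 lp lq) /\
  is_lim_seq (fun j => r6 (p j) (q j)) (r6 lp lq).
Proof.
  intros Hp Hq H. assert (HD : is_lim_seq (fun j => p j ^ 2 + q j ^ 2) (lp ^ 2 + lq ^ 2)).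
  { apply is_lim_seq_plus'; apply is_lim_seq_pow; auto. }
  repeat split.
  - apply is_lim_seq_div'; auto.
  - apply is_lim_seq_div'; [|apply is_lim_seq_pow; auto|apply pow_nonzero; auto].
    apply is_lim_seq_minus'; apply is_lim_seq_pow; auto.
  - apply is_lim_seq_div'; [|apply is_lim_seq_pow; auto|apply pow_nonzero; auto].
    apply is_lim_seq_minus'; [apply is_lim_seq_pow; auto|].
    apply is_lim_seq_mult'; [|apply is_lim_seq_pow; auto].
    apply is_lim_seq_mult'; auto; apply is_lim_seq_const.
Qed.

Lemma r_scaled (e p q : R) : e <> 0 ->
  r2 (p / e ^ 2) (q / e ^ 2) = e ^ 2 * r2 p q /\
  r4 (p / e ^ 2) (q / e ^ 2) = e ^ 4 * r4 p q /\
  r6 (p / e ^ 2) (q / e ^ 2) = e ^ 6 * r6 p q.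
Proof.
  intros He.
  assert (E : forall k, / ((p / e ^ 2) ^ 2 + (q / e ^ 2) ^ 2) ^ k
                        = (e ^ 4) ^ k * (/ (p ^ 2 + q ^ 2)) ^ k).
  { intros k. rewrite <- pow_inv, <- Rpow_mult_distr. f_equal.
    replace ((p / e ^ 2) ^ 2 + (q / e ^ 2) ^ 2) with (/ e ^ 4 * (p ^ 2 + q ^ 2)) by (field; auto).
    rewrite Rinv_mult, Rinv_inv; auto. }
  assert (E1 := E 1%nat). rewrite !pow_1 in E1.
  unfold r2, r4, r6, Rdiv at 1 4 7. unfold Rdiv in *. rewrite !E, E1.
  rewrite <- !pow_inv. generalize (/ (p ^ 2 + q ^ 2)). intros v.
  repeat split; field; auto.
Qed.

(** As e -> 0, sin^2 (e z)/e^2 tends to z^2; the leading term of the closed form tends to 1/z^4 or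
    1/z^6, and the lower ones keep a positive power of e. *)
Lemma f_limits (x y : R) :
  0 < x ^ 2 + y ^ 2 ->
  is_lim_seq (fun j => half_pow j ^ 4 * f4 (half_pow j * x) (half_pow j * y)) (c4 x y) /\
  is_lim_seq (fun j => half_pow j ^ 6 * f6 (half_pow j * x) (half_pow j * y)) (c6 x y).
Proof.
  intros H. destruct (is_lim_seq_trig_scaled x y) as [L1 L2].
  assert (N : (x ^ 2 - y ^ 2) ^ 2 + (2 * x * y) ^ 2 <> 0).
  { replace ((x ^ 2 - y ^ 2) ^ 2 + (2 * x * y) ^ 2) with ((x ^ 2 + y ^ 2) ^ 2) by ring.
    apply pow_nonzero; lra. }
  destruct (r_limits _ _ _ _ L1 L2 N) as [R2 [R4 R6]].
  assert (Hn : forall j, half_pow j <> 0) by (intros j; assert (K := half_pow_bounds j); lra).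
  assert (Q2 : is_lim_seq (fun j => half_pow j ^ 2 * r2 (sre (half_pow j * x) (half_pow j * y))
     (sim (half_pow j * x) (half_pow j * y))) (r2 (x ^ 2 - y ^ 2) (2 * x * y))).
  { apply is_lim_seq_ext with (2 := R2). intros j. apply r_scaled; auto. }
  assert (Q4 : is_lim_seq (fun j => half_pow j ^ 4 * r4 (sre (half_pow j * x) (half_pow j * y))
     (sim (half_pow j * x) (half_pow j * y))) (r4 (x ^ 2 - y ^ 2) (2 * x * y))).
  { apply is_lim_seq_ext with (2 := R4). intros j. apply r_scaled; auto. }
  assert (Q6 : is_lim_seq (fun j => half_pow j ^ 6 * r6 (sre (half_pow j * x) (half_pow j * y))
     (sim (half_pow j * x) (half_pow j * y))) (r6 (x ^ 2 - y ^ 2) (2 * x * y))).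
  { apply is_lim_seq_ext with (2 := R6). intros j. apply r_scaled; auto. }
  assert (P := fun k => is_lim_seq_pow _ _ k is_lim_seq_half_pow).
  clear R2 R4 R6 L1 L2. set (l2 := r2 (x ^ 2 - y ^ 2) (2 * x * y)) in *.
  split.
  - replace (c4 x y) with (c4 x y - 2 / 3 * 0 ^ 2 * l2) by (simpl; ring).
    apply is_lim_seq_ext with (2 := is_lim_seq_minus' _ _ _ _ Q4
      (is_lim_seq_mult' _ _ _ _ (is_lim_seq_mult' _ _ _ _ (is_lim_seq_const (2 / 3)) (P 2%nat)) Q2)).
    intros j; unfold f4; ring.
  - replace (c6 x y) with
      (c6 x y - 0 ^ 2 * r4 (x ^ 2 - y ^ 2) (2 * x * y) + 2 / 15 * 0 ^ 4 * l2) by (simpl; ring).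
    apply is_lim_seq_ext with (2 := is_lim_seq_plus' _ _ _ _
      (is_lim_seq_minus' _ _ _ _ Q6 (is_lim_seq_mult' _ _ _ _ (P 2%nat) Q4))
      (is_lim_seq_mult' _ _ _ _ (is_lim_seq_mult' _ _ _ _ (is_lim_seq_const (2 / 15)) (P 4%nat)) Q2)).
    intros j; unfold f6; ring.
Qed.

Lemma is_series_telescope : is_series (fun n => / (INR n + 1) - / (INR n + 2)) 1.
Proof.
  apply is_series_psum.
  apply is_lim_seq_ext with (fun n => 1 - / (INR n + 1)).
  - induction n as [|n IH]; simpl psum; [simpl; field|].
    rewrite <- IH, S_INR. assert (0 <= INR n) by apply pos_INR. field; lra.
  - replace (Finite 1) with (Finite (1 - 0)) by (f_equal; ring).
    apply is_lim_seq_minus'; [apply is_lim_seq_const|].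
    assert (L := is_lim_seq_INR). apply is_lim_seq_incr_1 in L.
    apply is_lim_seq_ext with (fun n => / INR (S n)).
    + intros n; rewrite S_INR; auto.
    + apply (is_lim_seq_inv _ p_infty); [exact L | discriminate].
Qed.

Lemma ex_series_inv_sq : ex_series (fun n => / INR (S n) ^ 2).
Proof.
  apply (ex_series_Rle _ (fun n => 2 * (/ (INR n + 1) - / (INR n + 2)))).
  - intros n. rewrite S_INR. assert (H : 0 <= INR n) by apply pos_INR.
    rewrite Rabs_pos_eq.
    2:{ left; apply Rinv_0_lt_compat, pow_lt; lra. }
    replace (2 * (/ (INR n + 1) - / (INR n + 2))) with (/ ((INR n + 1) * (INR n + 2) / 2))
      by (field; lra).
    apply Rinv_le_contravar; nra.
  - apply (ex_series_scal_l (V := R_NormedModule)). exists 1; apply is_series_telescope.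
Qed.

Lemma row_bound_ge_0 (x y : R) : 0 < x ^ 2 + y ^ 2 -> 0 <= row_bound x y.
Proof.
  intros H. unfold row_bound. assert (0 < 9 / (x ^ 2 + y ^ 2)) by (apply Rdiv_lt_0_compat; lra).
  assert (B2 := pow_lt _ 2 H0). assert (B3 := pow_lt _ 3 H0). lra.
Qed.

(** With v = / INR (S n) ^ 2 <= 1 and B <= 9 v: 819 = 9 + 81 + 729. *)
Lemma row_bound_le (n : nat) (x y : R) :
  INR (S n) <= Rabs x -> row_bound x y <= 819 * / INR (S n) ^ 2.
Proof.
  intros Hx. unfold row_bound. rewrite S_INR in *. assert (H : 0 <= INR n) by apply pos_INR.
  set (m := INR n + 1) in *. assert (Hm : 1 <= m) by (unfold m; lra).
  assert (Hsq : m ^ 2 <= x ^ 2 + y ^ 2).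
  { assert (0 <= y ^ 2) by apply pow2_ge_0. rewrite <- (pow2_abs x).
    assert (m ^ 2 <= Rabs x ^ 2) by (apply pow_incr; lra). lra. }
  assert (1 <= m ^ 2) by nra.
  assert (HB : 0 < 9 / (x ^ 2 + y ^ 2) <= 9 * / m ^ 2).
  { split; [apply Rdiv_lt_0_compat; lra|]. apply Rmult_le_compat_l; [lra|].
    apply Rinv_le_contravar; lra. }
  assert (Hv : 0 < / m ^ 2 <= 1).
  { split; [apply Rinv_0_lt_compat; lra|]. rewrite <- Rinv_1. apply Rinv_le_contravar; lra. }
  set (B := 9 / (x ^ 2 + y ^ 2)) in *. set (v := / m ^ 2) in *.
  assert (B ^ 2 <= 9 * (9 * v)) by (simpl; nra).
  assert (B ^ 3 <= 81 * (9 * v)).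
  { replace (B ^ 3) with (B ^ 2 * B) by ring. assert (0 < B ^ 2) by (apply pow_lt; lra).
    assert (B ^ 2 <= 81) by nra. nra. }
  lra.
Qed.

(** * Partial fractions by iterated duplication *)

Section RowSum.
Variables (f c : R -> R -> R) (e : nat).
Hypothesis f_double : forall x y, smod (2 * x) (2 * y) <> 0 ->
  f (2 * x) (2 * y) = (/ 2) ^ e * (f x y + f (x + PI / 2) y).
Hypothesis f_period : forall x y, f (x + PI) y = f x y.
Hypothesis f_bound : forall t x y, 0 < t <= 1 -> 0 < x ^ 2 + y ^ 2 -> Rabs (t * x) <= PI / 2 ->
  Rabs (t ^ e * f (t * x) (t * y)) <= row_bound x y.
Hypothesis f_limit : forall x y, 0 < x ^ 2 + y ^ 2 ->
  is_lim_seq (fun j => half_pow j ^ e * f (half_pow j * x) (half_pow j * y)) (c x y).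

Lemma smod_period (x y : R) (n : nat) :
  smod (x + INR n * PI) y = smod x y /\ smod (x - INR n * PI) y = smod x y.
Proof.
  unfold smod. assert (G : forall t n, sin (t + INR n * PI) ^ 2 = sin t ^ 2).
  { intros t m; induction m as [|m IH].
    - simpl INR. rewrite Rmult_0_l, Rplus_0_r; auto.
    - rewrite S_INR. replace (t + (INR m + 1) * PI) with (t + INR m * PI + PI) by ring.
      rewrite neg_sin, <- IH. ring. }
  split; [rewrite G; auto|].
  rewrite <- (G (x - INR n * PI) n). do 3 f_equal. ring.
Qed.

Lemma smod_halving (x y : R) (j : nat) :
  smod x y <> 0 -> smod (half_pow j * x) (half_pow j * y) <> 0.
Proof.
  intros H. assert (G : forall j, smod (/ 2 ^ j * x) (/ 2 ^ j * y) <> 0).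
  { induction j0 as [|k IH]; [simpl; rewrite Rinv_1, !Rmult_1_l; auto|].
    apply smod_double_neq_0. assert (2 ^ k <> 0) by (apply pow_nonzero; lra).
    replace (2 * (/ 2 ^ S k * x)) with (/ 2 ^ k * x) by (simpl; field; auto).
    replace (2 * (/ 2 ^ S k * y)) with (/ 2 ^ k * y) by (simpl; field; auto). exact IH. }
  apply G.
Qed.

(** The points x + n pi and x - (n+1) pi with n < 2^j are 2^(j+1) consecutive translates. For 0 <= x
    <= pi/2, scaling by [half_pow j] moves their real parts into [- pi/2, pi/2], where the majorant
    is valid. *)
Definition row_pair (x y : R) (j n : nat) : R :=
  f (half_pow j * (x + INR n * PI)) (half_pow j * y)
  + f (half_pow j * (x - INR (S n) * PI)) (half_pow j * y).

Lemma f_halving (x y : R) :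
  smod x y <> 0 -> f x y = (/ 2) ^ e * (f (/ 2 * x) (/ 2 * y) + f (/ 2 * x + PI / 2) (/ 2 * y))
  /\ f x y = (/ 2) ^ e * (f (/ 2 * x) (/ 2 * y) + f (/ 2 * x - PI / 2) (/ 2 * y)).
Proof.
  intros H. assert (E : f x y = (/ 2) ^ e * (f (/ 2 * x) (/ 2 * y) + f (/ 2 * x + PI / 2) (/ 2 * y))).
  { rewrite <- f_double; [f_equal; field|].
    replace (2 * (/ 2 * x)) with x by field. replace (2 * (/ 2 * y)) with y by field. auto. }
  split; auto. rewrite E. do 2 f_equal. rewrite <- (f_period (/ 2 * x - PI / 2)). f_equal. field.
Qed.

(** Halving z gives z/2 and a companion at distance pi/2 on either side, by periodicity. It is put
    on the left for a point on the right and conversely, which keeps all points in the range; pair n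
    then splits into the pairs n and 2^(j+1) - 1 - n. *)
Lemma row_pair_refine (x y : R) (j n : nat) :
  smod x y <> 0 -> (n < 2 ^ S j)%nat ->
  row_pair x y j n = (/ 2) ^ e * (row_pair x y (S j) n + row_pair x y (S j) (2 ^ S j - 1 - n)).
Proof.
  intros H Hn. unfold row_pair.
  assert (P2 : 2 ^ S j <> 0) by (apply pow_nonzero; lra).
  assert (Hh : half_pow (S j) = / 2 * half_pow j).
  { unfold half_pow. rewrite <- Rinv_mult. reflexivity. }
  assert (Hk : half_pow j * 2 ^ S j = 1) by (unfold half_pow; field; auto).
  rewrite (proj2 (f_halving (half_pow j * (x + INR n * PI)) (half_pow j * y) ltac:(
    apply smod_halving; rewrite (proj1 (smod_period x y n)); exact H))).
  rewrite (proj1 (f_halving (half_pow j * (x - INR (S n) * PI)) (half_pow j * y) ltac:(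
    apply smod_halving; rewrite (proj2 (smod_period x y (S n))); exact H))).
  rewrite Hh.
  assert (I : INR (2 ^ S j - 1 - n) = 2 ^ S j - 1 - INR n).
  { rewrite !minus_INR by lia. rewrite pow_INR. change (INR 2) with 2. change (INR 1) with 1. ring. }
  replace (/ 2 * half_pow j * (x + INR (2 ^ S j - 1 - n) * PI)) with
    (/ 2 * (half_pow j * (x - INR (S n) * PI)) + PI / 2).
  2:{ rewrite I, S_INR. replace (PI / 2) with (/ 2 * (half_pow j * 2 ^ S j) * PI) by (rewrite Hk; field).
      ring. }
  replace (/ 2 * half_pow j * (x - INR (S (2 ^ S j - 1 - n)) * PI)) with
    (/ 2 * (half_pow j * (x + INR n * PI)) - PI / 2).
  2:{ rewrite S_INR, I. replace (PI / 2) with (/ 2 * (half_pow j * 2 ^ S j) * PI) by (rewrite Hk; field).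
      ring. }
  rewrite !Rmult_assoc. ring.
Qed.

Lemma f_as_row_sum (x y : R) (j : nat) :
  smod x y <> 0 -> f x y = half_pow j ^ e * psum (row_pair x y j) (2 ^ j).
Proof.
  intros H. induction j as [|j IH].
  - simpl psum. unfold row_pair, half_pow. simpl pow. rewrite Rmult_1_r.
    rewrite (proj2 (f_halving x y H)). rewrite Rplus_0_l. simpl INR.
    replace (/ 2 * (x + 0 * PI)) with (/ 2 * x) by ring.
    replace (/ 2 * (x - 1 * PI)) with (/ 2 * x - PI / 2) by field. reflexivity.
  - rewrite IH.
    rewrite (psum_ext_lt (row_pair x y j) (fun n => (/ 2) ^ e *
      (row_pair x y (S j) n + row_pair x y (S j) (2 * 2 ^ j - 1 - n)))).
    + rewrite psum_scal, psum_fold, <- Rmult_assoc, <- Rpow_mult_distr.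
      f_equal. f_equal. unfold half_pow. rewrite <- Rinv_mult. f_equal.
      simpl; ring.
    + intros n Hn. apply row_pair_refine; auto. simpl; lia.
Qed.

(** The limit j -> oo in the exact finite sums of [f_as_row_sum]: each term tends to that of the
    series, and the scaled values are dominated independently of j. *)
Lemma is_series_row (x y : R) :
  0 <= x <= PI / 2 -> 0 < x ^ 2 + y ^ 2 ->
  is_series (fun n => c (x + INR n * PI) y + c (x - INR (S n) * PI) y) (f x y).
Proof.
  intros Hx Hxy.
  assert (HP := PI_RGT_0). assert (HP2 := PI2_3_2).
  assert (Hs : smod x y <> 0).
  { assert (L := smod_lower 1 x y). rewrite !Rmult_1_l in L.
    rewrite Rabs_pos_eq in L by lra. specialize (L (proj2 Hx)). lra. }
  assert (A1 : forall n, INR n * PI <= x + INR n * PI) by (intros; lra).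
  assert (A2 : forall n, INR (S n) <= Rabs (x - INR (S n) * PI)).
  { intros n. rewrite S_INR. assert (0 <= INR n) by apply pos_INR.
    rewrite Rabs_left1 by nra. nra. }
  assert (Q1 : forall n, 0 < (x + INR n * PI) ^ 2 + y ^ 2).
  { intros n. assert (0 <= INR n) by apply pos_INR. assert (0 <= y ^ 2) by apply pow2_ge_0.
    assert (x ^ 2 <= (x + INR n * PI) ^ 2) by (apply pow_incr; nra). lra. }
  assert (Q2 : forall n, 0 < (x - INR (S n) * PI) ^ 2 + y ^ 2).
  { intros n. assert (0 <= y ^ 2) by apply pow2_ge_0. rewrite <- pow2_abs.
    assert (K := A2 n). rewrite S_INR in K at 1. assert (0 <= INR n) by apply pos_INR.
    assert (0 < Rabs (x - INR (S n) * PI) ^ 2) by (apply pow_lt; lra). lra. }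
  set (b := fun n => row_bound (x + INR n * PI) y + row_bound (x - INR (S n) * PI) y).
  assert (Hb : ex_series b).
  (* The term n = 0 is split off, since x and y may be arbitrarily small; from n = 1 on, |x + n pi|
     >= n gives the bound. *)
  { apply ex_series_incr_1. apply (ex_series_Rle _ (fun n => 1638 * / INR (S n) ^ 2)).
    - intros n. unfold b. rewrite Rabs_pos_eq.
      2:{ apply Rplus_le_le_0_compat; apply row_bound_ge_0; auto. }
      assert (K1 : row_bound (x + INR (S n) * PI) y <= 819 * / INR (S n) ^ 2).
      { apply row_bound_le. assert (0 <= INR (S n)) by apply pos_INR. rewrite Rabs_pos_eq; nra. }
      assert (K2 : row_bound (x - INR (S (S n)) * PI) y <= 819 * / INR (S n) ^ 2).
      { apply row_bound_le. eapply Rle_trans; [|apply A2]. apply le_INR; lia. }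
      lra.
    - apply (ex_series_scal_l (V := R_NormedModule)), ex_series_inv_sq. }
  set (l := fun n => c (x + INR n * PI) y + c (x - INR (S n) * PI) y).
  (* Extended by 0 beyond the 2^j pairs, so that the finite sum becomes a series to which dominated
     convergence applies. *)
  set (a := fun j n => if Nat.ltb n (2 ^ j) then half_pow j ^ e * row_pair x y j n else 0).
  assert (Bd : forall j n, Rabs (a j n) <= b n).
  { intros j n. unfold a, b. destruct (Nat.ltb_spec n (2 ^ j)) as [Hn|Hn].
    2:{ rewrite Rabs_R0. apply Rplus_le_le_0_compat; apply row_bound_ge_0; auto. }
    assert (Hn' : INR (S n) <= 2 ^ j).
    { replace (2 ^ j) with (INR (2 ^ j)) by (rewrite pow_INR; reflexivity). apply le_INR; lia. }
    assert (Hj : half_pow j * 2 ^ j = / 2).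
    { unfold half_pow; simpl; field. apply pow_nonzero; lra. }
    assert (Hj0 := half_pow_bounds j). assert (0 <= INR n) by apply pos_INR.
    unfold row_pair. rewrite Rmult_plus_distr_l.
    eapply Rle_trans; [apply Rabs_triang|]. rewrite S_INR in Hn'.
    assert (0 < half_pow j * PI) by nra.
    apply Rplus_le_compat; apply f_bound; auto.
    - rewrite Rabs_pos_eq by nra.
      apply Rle_trans with (half_pow j * (2 ^ j * PI)); [apply Rmult_le_compat_l; nra|].
      rewrite <- Rmult_assoc, Hj; lra.
    - rewrite S_INR. rewrite Rabs_left1 by nra.
      apply Rle_trans with (half_pow j * (2 ^ j * PI)).
      + rewrite Ropp_mult_distr_r. apply Rmult_le_compat_l; nra.
      + rewrite <- Rmult_assoc, Hj; lra. }
  assert (Lm : forall n, filterlim (fun j => a j n) eventually (locally (l n))).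
  { intros n. change (is_lim_seq (fun j => a j n) (l n)).
    apply is_lim_seq_ext_loc with (fun j => half_pow j ^ e * row_pair x y j n).
    - exists n. intros j Hj. unfold a. destruct (Nat.ltb_spec n (2 ^ j)) as [_|Hn]; auto.
      exfalso. assert (K := Nat.pow_gt_lin_r 2 j). lia.
    - apply is_lim_seq_ext with (fun j =>
        half_pow j ^ e * f (half_pow j * (x + INR n * PI)) (half_pow j * y)
        + half_pow j ^ e * f (half_pow j * (x - INR (S n) * PI)) (half_pow j * y)).
      + intros j; unfold row_pair; ring.
      + apply is_lim_seq_plus'; apply f_limit; auto. }
  assert (L := filterlim_Series_dominated eventually a l b Hb (filter_forall _ Bd) Lm).
  assert (El := dominated_limit_ex_series eventually a l b Hb (filter_forall _ Bd) Lm).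
  replace (f x y) with (Series l); [apply Series_correct; exact El|].
  assert (L' : is_lim_seq (fun j => Series (a j)) (Series l)) by exact L.
  assert (C : is_lim_seq (fun j => Series (a j)) (f x y)).
  { apply is_lim_seq_ext with (fun _ => f x y); [|apply is_lim_seq_const].
    intros j. rewrite (Series_psum_eventually_zero (a j) (2 ^ j)).
    - rewrite (f_as_row_sum x y j Hs), <- psum_scal. apply psum_ext_lt; intros n Hn.
      unfold a. destruct (Nat.ltb_spec n (2 ^ j)); auto; lia.
    - intros n Hn. unfold a. destruct (Nat.ltb_spec n (2 ^ j)); auto; lia. }
  apply is_lim_seq_unique in L'. apply is_lim_seq_unique in C. rewrite L' in C.
  injection C; auto.
Qed.

End RowSum.

Lemma sre_sim_period (x y : R) : sre (x + PI) y = sre x y /\ sim (x + PI) y = sim x y.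
Proof. unfold sre, sim. rewrite neg_sin, neg_cos. split; ring. Qed.

Lemma is_series_row_4 (x y : R) :
  0 <= x <= PI / 2 -> 0 < x ^ 2 + y ^ 2 ->
  is_series (fun n => c4 (x + INR n * PI) y + c4 (x - INR (S n) * PI) y) (f4 x y).
Proof.
  apply (is_series_row f4 c4 4).
  - apply f4_double.
  - intros u v. unfold f4. destruct (sre_sim_period u v) as [-> ->]; auto.
  - intros; apply f_bounds; auto.
  - intros; apply f_limits; auto.
Qed.

Lemma is_series_row_6 (x y : R) :
  0 <= x <= PI / 2 -> 0 < x ^ 2 + y ^ 2 ->
  is_series (fun n => c6 (x + INR n * PI) y + c6 (x - INR (S n) * PI) y) (f6 x y).
Proof.
  apply (is_series_row f6 c6 6).
  - apply f6_double.
  - intros u v. unfold f6. destruct (sre_sim_period u v) as [-> ->]; auto.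
  - intros; apply f_bounds; auto.
  - intros; apply f_limits; auto.
Qed.

(** * Eisenstein series of a rectangular lattice *)

(** The numerators are the Eulerian polynomials; each fraction arises from the preceding one by w
    d/dw. *)
Lemma Eulerian_sums (w : R) : Rabs w < 1 ->
  is_series (fun n => INR n ^ 3 * w ^ n) (w * ((1 + 4 * w + w ^ 2) / (1 - w) ^ 4)) /\
  is_series (fun n => INR n ^ 5 * w ^ n)
    (w * ((1 + 26 * w + 66 * w ^ 2 + 26 * w ^ 3 + w ^ 4) / (1 - w) ^ 6)).
Proof.
  assert (Hw : forall w, Rabs w < 1 -> 1 - w <> 0).
  { intros v Hv. apply Rabs_def2 in Hv. lra. }
  assert (S0 : forall w, Rabs w < 1 -> is_series (fun n => INR n ^ 0 * w ^ n) (/ (1 - w))).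
  { intros v Hv. apply is_series_ext with (2 := is_series_geom v Hv). intros; simpl; ring. }
  assert (S1 := is_series_INR_pow_geom_S 0 _ (fun w => / (1 - w) ^ 2) S0 ltac:(
    intros v Hv; specialize (Hw v Hv); auto_derive; [auto|field; auto])).
  assert (S2 := is_series_INR_pow_geom_S 1 _ (fun w => (1 + w) / (1 - w) ^ 3) S1 ltac:(
    intros v Hv; specialize (Hw v Hv); auto_derive;
      [repeat split; auto; apply Rmult_integral_contrapositive_currified; lra|field; auto])).
  assert (S3 := is_series_INR_pow_geom_S 2 _ (fun w => (1 + 4 * w + w ^ 2) / (1 - w) ^ 4) S2 ltac:(
    intros v Hv; specialize (Hw v Hv); auto_derive;
      [repeat split; auto; repeat apply Rmult_integral_contrapositive_currified; lra|field; auto])).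
  assert (S4 := is_series_INR_pow_geom_S 3 _
    (fun w => (1 + 11 * w + 11 * w ^ 2 + w ^ 3) / (1 - w) ^ 5) S3 ltac:(
    intros v Hv; specialize (Hw v Hv); auto_derive;
      [repeat split; auto; repeat apply Rmult_integral_contrapositive_currified; lra|field; auto])).
  assert (S5 := is_series_INR_pow_geom_S 4 _
    (fun w => (1 + 26 * w + 66 * w ^ 2 + 26 * w ^ 3 + w ^ 4) / (1 - w) ^ 6) S4 ltac:(
    intros v Hv; specialize (Hw v Hv); auto_derive;
      [repeat split; auto; repeat apply Rmult_integral_contrapositive_currified; lra|field; auto])).
  intros H; split; auto.
Qed.

(** With w = e^(-2y) one has sin^2 (i y) = - (1 - w)^2/(4 w), which turns the closed form of a row
    into an Eulerian fraction in w: a Lipschitz formula. *)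
Lemma f_on_imaginary_axis (y : R) : 0 < y ->
  is_series (fun n => INR n ^ 3 * exp (- (2 * y)) ^ n) (3 / 8 * f4 0 y) /\
  is_series (fun n => INR n ^ 5 * exp (- (2 * y)) ^ n) (- (15 / 8) * f6 0 y).
Proof.
  intros Hy. destruct (exp_neg_lt_1 (2 * y) ltac:(lra)) as [H0 H1].
  set (w := exp (- (2 * y))) in *.
  destruct (Eulerian_sums w ltac:(rewrite Rabs_pos_eq; lra)) as [S3 S5].
  assert (Es : sinh y ^ 2 = (1 - w) ^ 2 / (4 * w)).
  { assert (Hv : exp y * exp (- y) = 1) by (rewrite <- exp_plus, Rplus_opp_r; apply exp_0).
    assert (Ew : w = exp (- y) * exp (- y)) by (unfold w; rewrite <- exp_plus; f_equal; ring).
    unfold sinh. rewrite Ew. set (v := exp (- y)) in *.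
    assert (0 < v) by apply exp_pos. replace (exp y) with (/ v).
    - field; lra.
    - apply Rmult_eq_reg_r with v; [|lra]. rewrite Rinv_l by lra. lra. }
  assert (Er : sre 0 y = - ((1 - w) ^ 2 / (4 * w))).
  { unfold sre. rewrite sin_0, cos_0, Es. ring. }
  assert (Ei : sim 0 y = 0) by (unfold sim; rewrite sin_0; ring).
  unfold f4, f6, r2, r4, r6. rewrite Er, Ei.
  assert (N1 : 1 - w <> 0) by lra. assert (N2 : w <> 0) by lra.
  split.
  - replace (3 / 8 * _) with (w * ((1 + 4 * w + w ^ 2) / (1 - w) ^ 4)) by (field; lra). exact S3.
  - replace (- (15 / 8) * _) with
      (w * ((1 + 26 * w + 66 * w ^ 2 + 26 * w ^ 3 + w ^ 4) / (1 - w) ^ 6)) by (field; lra).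
    exact S5.
Qed.

Lemma psum_Series (a : nat -> nat -> R) (N : nat) :
  (forall m, ex_series (a m)) ->
  ex_series (fun d => psum (fun m => a m d) N) /\
  psum (fun m => Series (a m)) N = Series (fun d => psum (fun m => a m d) N).
Proof.
  intros H. induction N as [|N [IH1 IH2]]; simpl.
  - split; [exists 0; apply is_series_psum; apply is_lim_seq_ext with (fun _ => 0)|].
    + induction n as [|n IH]; simpl; lra.
    + apply is_lim_seq_const.
    + symmetry; apply Series_psum_eventually_zero with (N := 0%nat); auto.
  - split; [apply (ex_series_plus (V := R_NormedModule)); auto|].
    rewrite IH2, Series_plus; auto.
Qed.

Lemma is_lim_seq_psum_exp (d : nat) (h : R) :
  0 < h -> (0 < d)%nat ->
  is_lim_seq (psum (fun m => exp (- (INR (S m) * h)) ^ d)) (lam d h).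
Proof.
  intros Hh Hd. apply is_series_psum.
  set (w := exp (- (INR d * h))).
  assert (Hw : 0 < w < 1).
  { apply exp_neg_lt_1. apply Rmult_lt_0_compat; auto. apply lt_0_INR; auto. }
  apply is_series_ext with (fun m => w * w ^ m).
  - intros m. change (w * w ^ m) with (w ^ S m). unfold w.
    rewrite <- !exp_INR_mul. f_equal. ring.
  - replace (lam d h) with (w * / (1 - w)).
    + apply (is_series_scal_l (V := R_NormedModule)). apply is_series_geom.
      rewrite Rabs_pos_eq; lra.
    + unfold lam, w in *. rewrite exp_Ropp in *. assert (0 < exp (INR d * h)) by apply exp_pos.
      assert (exp (INR d * h) - 1 <> 0).
      { intros E. replace (exp (INR d * h)) with 1 in Hw by lra. rewrite Rinv_1 in Hw; lra. }
      field. repeat split; lra.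
Qed.

(** Interchange of the sums over rows and over n. For fixed d the powers form a geometric series
    with sum [lam d h], and its partial sums increase, so that the series [mom] itself is the
    majorant. *)
Lemma is_series_Lambert (i : nat) (h : R) (g : nat -> R) :
  0 < h ->
  (forall m, is_series (fun n => INR n ^ S i * exp (- (INR (S m) * h)) ^ n) (g m)) ->
  is_series g (mom (S i) h).
Proof.
  intros Hh Hg. apply is_series_psum.
  set (a := fun N d => INR d ^ S i * psum (fun m => exp (- (INR (S m) * h)) ^ d) N).
  apply is_lim_seq_ext with (fun N => Series (a N)).
  - intros N. unfold a.
    destruct (psum_Series (fun m n => INR n ^ S i * exp (- (INR (S m) * h)) ^ n) N) as [_ E].
    { intros m; exists (g m); apply Hg. }
    rewrite (psum_ext g (fun m => Series (fun n => INR n ^ S i * exp (- (INR (S m) * h)) ^ n))).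
    + rewrite E. apply Series_ext; intros d. rewrite psum_scal; auto.
    + intros m. symmetry; apply is_series_unique, Hg.
  - apply (filterlim_Series_dominated eventually a _ _ (ex_series_mom (S i) h Hh)).
    + apply filter_forall. intros N d. unfold a.
      rewrite Rabs_mult, (Rabs_pos_eq (INR d ^ S i)) by apply pow_le, pos_INR.
      destruct d as [|d]; [simpl; lra|].
      apply Rmult_le_compat_l; [apply pow_le, pos_INR|].
      assert (L := is_lim_seq_psum_exp (S d) h Hh (Nat.lt_0_succ d)).
      assert (P : forall m, 0 <= exp (- (INR (S m) * h)) ^ S d).
      { intros m; apply pow_le; left; apply exp_pos. }
      rewrite Rabs_pos_eq.
      * apply (is_lim_seq_incr_compare _ _ L). intros n; cbn [psum]; specialize (P n); lra.
      * induction N as [|N IH]; cbn [psum]; [lra|]. specialize (P N); lra.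
    + intros d. unfold a. change (is_lim_seq (fun N => INR d ^ S i *
        psum (fun m => exp (- (INR (S m) * h)) ^ d) N) (INR d ^ S i * lam d h)).
      destruct d as [|d].
      * apply is_lim_seq_ext with (fun _ => INR 0 ^ S i * lam 0 h); [|apply is_lim_seq_const].
        intros; simpl; ring.
      * apply is_lim_seq_mult'; [apply is_lim_seq_const|].
        apply is_lim_seq_psum_exp; auto; lia.
Qed.

Lemma sum_over_rows (y : R) : 0 < y ->
  is_series (fun m => f4 0 (INR (S m) * y)) (8 / 3 * mom 3 (2 * y)) /\
  is_series (fun m => f6 0 (INR (S m) * y)) (- (8 / 15) * mom 5 (2 * y)).
Proof.
  intros Hy.
  assert (Hm : forall m, 0 < INR (S m) * y).
  { intros; apply Rmult_lt_0_compat; auto. apply lt_0_INR; lia. }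
  assert (A : forall m, - (2 * (INR (S m) * y)) = - (INR (S m) * (2 * y))) by (intros; ring).
  split.
  - assert (L := is_series_Lambert 2 (2 * y) (fun m => 3 / 8 * f4 0 (INR (S m) * y)) ltac:(lra)
      ltac:(intros m; rewrite <- A; apply (f_on_imaginary_axis _ (Hm m)))).
    apply (is_series_scal_l (V := R_NormedModule) (8 / 3)) in L.
    apply is_series_ext with (2 := L). intros m. unfold scal; simpl; unfold mult; simpl; field.
  - assert (L := is_series_Lambert 4 (2 * y) (fun m => - (15 / 8) * f6 0 (INR (S m) * y)) ltac:(lra)
      ltac:(intros m; rewrite <- A; apply (f_on_imaginary_axis _ (Hm m)))).
    apply (is_series_scal_l (V := R_NormedModule) (- (8 / 15))) in L.
    apply is_series_ext with (2 := L). intros m. unfold scal; simpl; unfold mult; simpl; field.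
Qed.

Lemma c_even (x y : R) :
  c4 (- x) y = c4 x y /\ c4 x (- y) = c4 x y /\ c6 (- x) y = c6 x y /\ c6 x (- y) = c6 x y.
Proof.
  unfold c4, c6.
  replace (2 * - x * y) with (- (2 * x * y)) by ring.
  replace (2 * x * - y) with (- (2 * x * y)) by ring.
  replace ((- x) ^ 2) with (x ^ 2) by ring. replace ((- y) ^ 2) with (y ^ 2) by ring.
  set (p := x ^ 2 - y ^ 2). set (q := 2 * x * y). unfold r4, r6.
  replace ((- q) ^ 2) with (q ^ 2) by ring. auto.
Qed.

Lemma c_bound (x y : R) : 0 < x ^ 2 + y ^ 2 ->
  Rabs (c4 x y) <= (/ (x ^ 2 + y ^ 2)) ^ 2 /\ Rabs (c6 x y) <= (/ (x ^ 2 + y ^ 2)) ^ 3.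
Proof.
  intros H. split; [apply r4_bound | apply r6_bound]; auto; ring.
Qed.

Lemma Rabs_le_inv_sq_psum (u : nat -> R) (C : R) :
  0 <= C -> (forall n, Rabs (u n) <= C * / INR (S n) ^ 2) ->
  ex_series u /\ forall N, Rabs (psum u N) <= C * Series (fun n => / INR (S n) ^ 2).
Proof.
  intros HC Hu.
  assert (Ez := ex_series_inv_sq).
  split.
  - apply (ex_series_Rle _ _ Hu). apply (ex_series_scal_l (V := R_NormedModule)); auto.
  - intros N. eapply Rle_trans; [apply psum_abs|].
    eapply Rle_trans; [apply psum_le; intros; apply Hu|].
    rewrite psum_scal. apply Rmult_le_compat_l; auto. apply psum_le_Series; auto.
    intros n. left; apply Rinv_0_lt_compat, pow_lt, lt_0_INR; lia.
Qed.

Section LatticeSum.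
Variables (c f : R -> R -> R) (k : nat) (v : R).
Hypothesis c_even_l : forall x y, c (- x) y = c x y.
Hypothesis c_even_r : forall x y, c x (- y) = c x y.
Hypothesis c_zero : c 0 0 = 0.
Hypothesis c_le : forall x y, 0 < x ^ 2 + y ^ 2 -> Rabs (c x y) <= (/ (x ^ 2 + y ^ 2)) ^ S (S k).
Hypothesis c_half : forall x, x <> 0 -> c (2 * x) 0 = (/ 2) ^ (4 + 2 * k) * c x 0.
Hypothesis row : forall x y, 0 <= x <= PI / 2 -> 0 < x ^ 2 + y ^ 2 ->
  is_series (fun n => c (x + INR n * PI) y + c (x - INR (S n) * PI) y) (f x y).

(** The weight is 4 + 2k. One factor 1/|z|^2 is estimated by each coordinate and the remaining k by
    1; the bound is summable in both directions. *)
Lemma lattice_term_le (y : R) (n m : nat) : 0 < y ->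
  Rabs (c (INR (S n) * PI) (INR (S m) * y)) <= / y ^ 2 * / INR (S m) ^ 2 * / INR (S n) ^ 2.
Proof.
  intros Hy. assert (HP := PI2_3_2).
  assert (Hn : 1 <= INR (S n)) by (rewrite S_INR; assert (K := pos_INR n); lra).
  assert (Hm : 1 <= INR (S m)) by (rewrite S_INR; assert (K := pos_INR m); lra).
  set (a := INR (S n)) in *. set (b := INR (S m)) in *.
  set (D := (a * PI) ^ 2 + (b * y) ^ 2).
  assert (K1 : a ^ 2 <= D).
  { unfold D. assert (0 <= (b * y) ^ 2) by apply pow2_ge_0.
    assert (a ^ 2 <= (a * PI) ^ 2) by (apply pow_incr; nra). lra. }
  assert (K2 : b ^ 2 * y ^ 2 <= D).
  { unfold D. assert (0 <= (a * PI) ^ 2) by apply pow2_ge_0. rewrite <- Rpow_mult_distr. lra. }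
  assert (a2 : 1 <= a ^ 2) by nra.
  assert (b2 : 0 < b ^ 2 * y ^ 2) by (apply Rmult_lt_0_compat; apply pow_lt; lra).
  eapply Rle_trans; [apply c_le; fold D; lra|]. fold D.
  assert (HiD : 0 < / D <= 1).
  { split; [apply Rinv_0_lt_compat; lra|]. rewrite <- Rinv_1. apply Rinv_le_contravar; lra. }
  replace (/ y ^ 2 * / b ^ 2 * / a ^ 2) with (/ (b ^ 2 * y ^ 2) * / a ^ 2)
    by (rewrite Rinv_mult; ring).
  replace ((/ D) ^ S (S k)) with ((/ D * / D) * (/ D) ^ k) by (simpl; ring).
  assert (0 <= (/ D) ^ k <= 1).
  { split; [apply pow_le; lra|]. rewrite <- (pow1 k). apply pow_incr; lra. }
  assert (/ D * / D <= / (b ^ 2 * y ^ 2) * / a ^ 2).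
  { apply Rmult_le_compat; try lra; apply Rinv_le_contravar; lra. }
  assert (0 < / D * / D) by (apply Rmult_lt_0_compat; lra). nra.
Qed.

(** The first argument of [c] runs along Omega', with unit pi, and m counts the rows. Evenness has
    folded - n onto n: this is the part |n| <= N of row m. *)
Definition inner (y : R) (N m : nat) : R :=
  c 0 (INR m * y) + 2 * psum (fun n => c (INR (S n) * PI) (INR m * y)) N.

Lemma inner_limit (y : R) (m : nat) : 0 < y ->
  is_lim_seq (fun N => inner y N (S m)) (f 0 (INR (S m) * y)).
Proof.
  intros Hy. assert (HP := PI_RGT_0). set (Y := INR (S m) * y).
  assert (HY : 0 < Y) by (apply Rmult_lt_0_compat; auto; apply lt_0_INR; lia).
  assert (Rw := row 0 Y ltac:(lra) ltac:(assert (0 < Y ^ 2) by (apply pow_lt; auto); lra)).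
  apply is_series_psum in Rw.
  destruct (Rabs_le_inv_sq_psum (fun n => c (INR (S n) * PI) Y) (/ y ^ 2 * / INR (S m) ^ 2)) as [Ex _].
  { apply Rmult_le_pos; left; apply Rinv_0_lt_compat, pow_lt; auto; apply lt_0_INR; lia. }
  { intros n; apply lattice_term_le; auto. }
  assert (L0 : is_lim_seq (fun N => c (INR N * PI) Y) 0).
  { apply is_lim_seq_incr_1. apply ex_series_lim_0 in Ex. exact Ex. }
  replace (Finite (f 0 Y)) with (Finite (f 0 Y + 0)) by (f_equal; ring).
  apply is_lim_seq_ext with (2 := is_lim_seq_plus' _ _ _ _ Rw L0).
  intros N. unfold inner. fold Y. induction N as [|N IH]; cbn [psum].
  - simpl INR. rewrite Rmult_0_l. ring.
  - replace (0 + INR N * PI) with (INR N * PI) by ring.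
    replace (0 - INR (S N) * PI) with (- (INR (S N) * PI)) by ring. rewrite c_even_l.
    lra.
Qed.

(** The row through 0 has to be summed without its pole. Its odd multiples of pi are twice the
    points of the row through pi/2, where the closed form holds, and its even multiples are twice
    the row itself; so the sum over positive points satisfies S = 2^-(4+2k) (v/2 + S). For v = 1/3
    and 2/15 this gives zeta(4)/pi^4 = 1/90 and zeta(6)/pi^6 = 1/945. *)
Lemma zeta_value :
  f (PI / 2) 0 = v ->
  is_series (fun n => c (INR (S n) * PI) 0) ((/ 2) ^ (4 + 2 * k) * (v / 2) / (1 - (/ 2) ^ (4 + 2 * k))).
Proof.
  intros Hv. assert (HP := PI2_3_2).
  set (a := fun n => c (INR (S n) * PI) 0). set (r := (/ 2) ^ (4 + 2 * k)).
  assert (Hr : r < 1).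
  { unfold r. replace (4 + 2 * k)%nat with (S (3 + 2 * k)) by lia. simpl pow.
    assert (0 <= (/ 2) ^ (k + (k + 0)) <= 1).
    { split; [apply pow_le; lra|]. rewrite <- (pow1 (k + (k + 0))). apply pow_incr; lra. }
    lra. }
  assert (Ex : ex_series a).
  { apply (Rabs_le_inv_sq_psum a 1); [lra|]. intros n. unfold a.
    assert (Hn : 1 <= INR (S n)) by (rewrite S_INR; assert (K := pos_INR n); lra).
    set (t := INR (S n)) in *. assert (K : t ^ 2 <= (t * PI) ^ 2) by (apply pow_incr; nra).
    assert (K1 : 1 <= t ^ 2) by nra.
    eapply Rle_trans; [apply c_le; lra|].
    replace ((t * PI) ^ 2 + 0 ^ 2) with ((t * PI) ^ 2) by ring.
    assert (HI : 0 < / (t * PI) ^ 2 <= / t ^ 2).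
    { split; [apply Rinv_0_lt_compat; lra | apply Rinv_le_contravar; lra]. }
    assert (H1 : / t ^ 2 <= 1) by (rewrite <- Rinv_1; apply Rinv_le_contravar; lra).
    change ((/ (t * PI) ^ 2) ^ S (S k)) with (/ (t * PI) ^ 2 * (/ (t * PI) ^ 2) ^ S k).
    assert (0 <= (/ (t * PI) ^ 2) ^ S k <= 1).
    { split; [apply pow_le; lra|]. rewrite <- (pow1 (S k)). apply pow_incr; lra. }
    nra. }
  assert (Rw := row (PI / 2) 0 ltac:(lra) ltac:(assert (0 < (PI / 2) ^ 2) by (apply pow_lt; lra); lra)).
  rewrite Hv in Rw. apply is_series_psum in Rw.
  assert (La := proj1 (is_series_psum _ _) (Series_correct _ Ex)).
  assert (Ls : is_lim_seq (fun N => psum a (2 * N)) (r * (v / 2 + Series a))).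
  { apply is_lim_seq_ext with (fun N => r * (psum (fun n => c (PI / 2 + INR n * PI) 0
      + c (PI / 2 - INR (S n) * PI) 0) N * / 2 + psum a N)).
    - induction n as [|n IH]; [simpl; ring|].
      replace (2 * S n)%nat with (S (S (2 * n))) by lia. cbn [psum]. rewrite <- IH.
      assert (E1 : a (2 * n)%nat = r * c (PI / 2 + INR n * PI) 0).
      { unfold a, r. rewrite <- c_half.
        - f_equal. rewrite S_INR, mult_INR. simpl INR. field.
        - assert (K := pos_INR n). nra. }
      assert (E2 : a (S (2 * n)) = r * a n).
      { unfold a, r. rewrite <- c_half.
        - f_equal. rewrite !S_INR, mult_INR. simpl INR. ring.
        - rewrite S_INR. assert (K := pos_INR n). nra. }
      assert (E3 : c (PI / 2 - INR (S n) * PI) 0 = c (PI / 2 + INR n * PI) 0).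
      { rewrite <- c_even_l. f_equal. rewrite S_INR. field. }
      rewrite E1, E2, E3. field.
    - unfold Rdiv. apply is_lim_seq_mult'; [apply is_lim_seq_const|].
      apply is_lim_seq_plus'; auto. apply is_lim_seq_mult'; auto. apply is_lim_seq_const. }
  assert (Ls' : is_lim_seq (fun N => psum a (2 * N)) (Series a)).
  { apply (is_lim_seq_subseq _ _ (fun N => (2 * N)%nat)) in La; auto.
    apply eventually_subseq. intros n; lia. }
  apply is_lim_seq_unique in Ls. apply is_lim_seq_unique in Ls'. rewrite Ls in Ls'.
  injection Ls' as E.
  replace (r * (v / 2) / (1 - r)) with (Series a); [apply Series_correct; auto|].
  apply Rmult_eq_reg_r with (1 - r); [|lra]. field_simplify; lra.
Qed.

(** [N] truncates both the rows and their number, so this is not an iterated limit. A majorant of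
    row m that is uniform in [N] allows taking the limits of the rows first. *)
Lemma lattice_sum_limit (y z s : R) :
  0 < y ->
  is_series (fun n => c (INR (S n) * PI) 0) z ->
  is_series (fun m => f 0 (INR (S m) * y)) s ->
  is_lim_seq (fun N => inner y N 0 + 2 * psum (fun m => inner y N (S m)) N) (2 * z + 2 * s).
Proof.
  intros Hy Hz Hs.
  apply is_lim_seq_plus'.
  - apply is_lim_seq_ext with (fun N => 2 * psum (fun n => c (INR (S n) * PI) 0) N).
    + intros N. unfold inner. simpl INR. rewrite Rmult_0_l, c_zero. ring.
    + apply is_lim_seq_mult'; [apply is_lim_seq_const|]. apply is_series_psum; auto.
  - apply is_lim_seq_mult'; [apply is_lim_seq_const|].
    set (Z2 := Series (fun n => / INR (S n) ^ 2)).
    (* First the point n = 0 of a row, then the others, estimated by [lattice_term_le] and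
       zeta(2). *)
    set (K := (/ y ^ 2) ^ S (S k) + 2 * (/ y ^ 2 * Z2)).
    assert (Hy2 : 0 < / y ^ 2) by (apply Rinv_0_lt_compat, pow_lt; auto).
    set (a := fun N m => if Nat.ltb m N then inner y N (S m) else 0).
    rewrite <- (is_series_unique _ _ Hs).
    apply is_lim_seq_ext with (fun N => Series (a N)).
    { intros N. rewrite (Series_psum_eventually_zero (a N) N).
      - apply psum_ext_lt; intros m Hm. unfold a. destruct (Nat.ltb_spec m N); auto; lia.
      - intros m Hm. unfold a. destruct (Nat.ltb_spec m N); auto; lia. }
    assert (Z0 : 0 <= Z2).
    { assert (Q := psum_le_Series (fun n => / INR (S n) ^ 2) 0). apply Q.
      - intros n. left; apply Rinv_0_lt_compat, pow_lt, lt_0_INR; lia.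
      - apply ex_series_inv_sq. }
    assert (K0 : 0 <= K).
    { unfold K. apply Rplus_le_le_0_compat; [apply pow_le; lra|].
      apply Rmult_le_pos; [lra|]. apply Rmult_le_pos; lra. }
    apply (filterlim_Series_dominated eventually a _ (fun m => K * / INR (S m) ^ 2)).
    + apply (ex_series_scal_l (V := R_NormedModule)), ex_series_inv_sq.
    + apply filter_forall. intros N m. unfold a.
      assert (Hm : 1 <= INR (S m)) by (rewrite S_INR; assert (Q := pos_INR m); lra).
      assert (Hm2 : 1 <= INR (S m) ^ 2) by nra.
      assert (Hi : 0 < / INR (S m) ^ 2 <= 1).
      { split; [apply Rinv_0_lt_compat; lra|]. rewrite <- Rinv_1. apply Rinv_le_contravar; lra. }
      destruct (Nat.ltb m N); [|rewrite Rabs_R0; apply Rmult_le_pos; lra].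
      unfold inner. eapply Rle_trans; [apply Rabs_triang|]. unfold K.
      rewrite Rmult_plus_distr_r. apply Rplus_le_compat.
      * eapply Rle_trans; [apply c_le|].
        { assert (0 < (INR (S m) * y) ^ 2) by (apply pow_lt; nra). lra. }
        replace (0 ^ 2 + (INR (S m) * y) ^ 2) with (INR (S m) ^ 2 * y ^ 2) by ring.
        rewrite Rinv_mult, Rpow_mult_distr, Rmult_comm.
        apply Rmult_le_compat_l; [apply pow_le; lra|].
        set (u := / INR (S m) ^ 2) in *. change (u ^ S (S k)) with (u * u ^ S k).
        assert (0 <= u ^ S k <= 1).
        { split; [apply pow_le; lra|]. rewrite <- (pow1 (S k)). apply pow_incr; lra. }
        nra.
      * rewrite Rabs_mult, (Rabs_pos_eq 2) by lra. rewrite Rmult_assoc.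
        apply Rmult_le_compat_l; [lra|].
        destruct (Rabs_le_inv_sq_psum (fun n => c (INR (S n) * PI) (INR (S m) * y))
          (/ y ^ 2 * / INR (S m) ^ 2)) as [_ B].
        { apply Rmult_le_pos; lra. }
        { intros n; apply lattice_term_le; auto. }
        eapply Rle_trans; [apply B|]. fold Z2. right; ring.
    + intros m. change (is_lim_seq (fun N => a N m) (f 0 (INR (S m) * y))).
      apply is_lim_seq_ext_loc with (fun N => inner y N (S m)).
      * exists (S m). intros N HN. unfold a. destruct (Nat.ltb_spec m N); auto; lia.
      * apply inner_limit; auto.
Qed.

End LatticeSum.

(** * From complex partial sums to real row sums *)

Definition lsum (l : list R) : R := fold_right Rplus 0 l.

Lemma lsum_app (l1 l2 : list R) : lsum (l1 ++ l2) = lsum l1 + lsum l2.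
Proof. induction l1 as [|a l IH]; simpl; [ring|]. unfold lsum in *; rewrite IH; ring. Qed.

Lemma Re_fold_Cplus (l : list C) : Re (fold_right Cplus (RtoC 0) l) = lsum (map Re l).
Proof. induction l as [|a l IH]; simpl; auto. unfold lsum, Re in *; simpl; rewrite <- IH; auto. Qed.

Lemma lsum_flat_map {A} (g : A -> list C) (l : list A) :
  lsum (map Re (flat_map g l)) = lsum (map (fun m => lsum (map Re (g m))) l).
Proof.
  induction l as [|a l IH]; simpl; auto. rewrite map_app, lsum_app, IH. auto.
Qed.

Lemma zrange_S (N : nat) :
  zrange (S N) = ((- Z.of_nat (S N))%Z :: zrange N ++ Z.of_nat (S N) :: nil).
Proof.
  unfold zrange.
  replace (2 * S N + 1)%nat with (S (S (2 * N + 1))) by lia.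
  rewrite seq_S. change (seq 0 (S (2 * N + 1))) with (0%nat :: seq 1 (2 * N + 1)).
  rewrite <- seq_shift, map_app, !map_cons, map_map. cbn [app map].
  f_equal. f_equal; [apply map_ext; intros; lia|]. f_equal. lia.
Qed.

Lemma lsum_zrange (f : Z -> R) (N : nat) :
  lsum (map f (zrange N)) =
  f 0%Z + psum (fun n => f (Z.of_nat (S n)) + f (- Z.of_nat (S n))%Z) N.
Proof.
  induction N as [|N IH]; [unfold lsum; simpl; ring|].
  rewrite zrange_S, map_cons, map_app.
  change (lsum (f (- Z.of_nat (S N))%Z :: map f (zrange N) ++ map f (Z.of_nat (S N) :: nil)))
    with (f (- Z.of_nat (S N))%Z + lsum (map f (zrange N) ++ map f (Z.of_nat (S N) :: nil))).
  assert (E : forall x, lsum (map f (x :: nil)) = f x) by (intros; unfold lsum; simpl; ring).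
  rewrite lsum_app, IH, E. cbn [psum]. ring.
Qed.

Lemma Re_Cinv_Cpow (x y : R) : 0 < x ^ 2 + y ^ 2 ->
  Re (Cinv (Cpow (x, y) 4)) = c4 x y /\ Re (Cinv (Cpow (x, y) 6)) = c6 x y.
Proof.
  intros H. unfold c4, c6, r4, r6, Cinv, Cpow, Cmult, RtoC, Re; simpl.
  split; field; (split || idtac);
    match goal with |- ?e <> 0 =>
      first [ replace e with ((x ^ 2 + y ^ 2) ^ 2) by ring
            | replace e with ((x ^ 2 + y ^ 2) ^ 4) by ring
            | replace e with ((x ^ 2 + y ^ 2) ^ 6) by ring ] end;
    apply pow_nonzero; lra.
Qed.

(** b + i a is i times the conjugate of a + i b, so apart from the scaling the real parts change by
    i^4 = 1 and i^6 = -1. This is where the sign in g3 comes from. *)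
Lemma c_rotate_scale (u a b : R) : u <> 0 -> 0 < a ^ 2 + b ^ 2 ->
  c4 (u * b) (u * a) = (/ u) ^ 4 * c4 a b /\ c6 (u * b) (u * a) = - (/ u) ^ 6 * c6 a b.
Proof.
  intros Hu H. unfold c4, c6, r4, r6.
  assert (N : (a ^ 2 + b ^ 2) ^ 2 <> 0) by (apply pow_nonzero; lra).
  replace (((u * b) ^ 2 - (u * a) ^ 2) ^ 2 + (2 * (u * b) * (u * a)) ^ 2)
    with (u ^ 4 * (a ^ 2 + b ^ 2) ^ 2) by ring.
  replace ((a ^ 2 - b ^ 2) ^ 2 + (2 * a * b) ^ 2) with ((a ^ 2 + b ^ 2) ^ 2) by ring.
  split; field; split; auto; lra.
Qed.

(** The lattice point is (2s/pi)(m y + i n pi); its coordinates are exchanged against the arguments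
    of [c], the first of which runs along Omega'. *)
Lemma Re_eis_partial (k N : nat) (Om s g : R) (c : R -> R -> R) :
  0 < Om -> 0 < s ->
  (forall x y, c (- x) y = c x y) -> (forall x y, c x (- y) = c x y) -> c 0 0 = 0 ->
  (forall x y, 0 < x ^ 2 + y ^ 2 ->
     Re (Cinv (Cpow (2 * s / PI * y, 2 * s / PI * x) k)) = g * c x y) ->
  let y := PI * Om / s in
  Re (eis_partial k (Om, 0) (0, s) N) =
  g * (inner c y N 0 + 2 * psum (fun m => inner c y N (S m)) N).
Proof.
  intros HOm Hs Hl Hr H0 Hc y. assert (HP := PI_RGT_0).
  assert (Hy : 0 < y) by (unfold y; apply Rdiv_lt_0_compat; nra).
  unfold eis_partial. rewrite Re_fold_Cplus, lsum_flat_map.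
  assert (T : forall m n, Re (if (Z.eqb m 0 && Z.eqb n 0)%bool then RtoC 0
      else Cinv (Cpow (lattice_pt (Om, 0) (0, s) m n) k)) = g * c (IZR n * PI) (IZR m * y)).
  { intros m n. destruct (Z.eqb m 0 && Z.eqb n 0)%bool eqn:E.
    - apply andb_prop in E. destruct E as [E1 E2].
      apply Z.eqb_eq in E1. apply Z.eqb_eq in E2. subst m n.
      rewrite !Rmult_0_l, H0. simpl; ring.
    - rewrite <- Hc.
      + do 3 f_equal. unfold lattice_pt, Cplus, Cmult, RtoC; simpl.
        f_equal; unfold y; field; lra.
      + destruct (Z.eq_dec n 0) as [->|Hn].
        * destruct (Z.eq_dec m 0) as [->|Hm]; [discriminate|].
          assert (IZR m * y <> 0).
          { apply Rmult_integral_contrapositive_currified; [apply not_0_IZR; auto | lra]. }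
          assert (0 < (IZR m * y) ^ 2) by (apply pow2_gt_0; auto).
          rewrite Rmult_0_l; lra.
        * assert (IZR n * PI <> 0).
          { apply Rmult_integral_contrapositive_currified; [apply not_0_IZR; auto | lra]. }
          assert (0 < (IZR n * PI) ^ 2) by (apply pow2_gt_0; auto).
          assert (0 <= (IZR m * y) ^ 2) by apply pow2_ge_0. lra. }
  assert (I : forall m, lsum (map Re (map (fun n => if (Z.eqb m 0 && Z.eqb n 0)%bool then RtoC 0
      else Cinv (Cpow (lattice_pt (Om, 0) (0, s) m n) k)) (zrange N)))
      = g * (c 0 (IZR m * y) + 2 * psum (fun n => c (INR (S n) * PI) (IZR m * y)) N)).
  { intros m. rewrite map_map. rewrite lsum_zrange. rewrite T.
    rewrite (psum_ext _ (fun n => (2 * g) * c (INR (S n) * PI) (IZR m * y))).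
    - rewrite psum_scal, Rmult_0_l. ring.
    - intros n. rewrite !T, opp_IZR, <- INR_IZR_INZ.
      rewrite <- Ropp_mult_distr_l, Hl. ring. }
  rewrite lsum_zrange.
  rewrite (psum_ext _ (fun m => (2 * g) * inner c y N (S m))).
  - rewrite I, psum_scal. unfold inner. simpl (INR 0). ring.
  - intros m. rewrite !I, opp_IZR, <- INR_IZR_INZ. unfold inner.
    rewrite <- Ropp_mult_distr_l, Hr.
    rewrite (psum_ext (fun n => c (INR (S n) * PI) (- (INR (S m) * y)))
      (fun n => c (INR (S n) * PI) (INR (S m) * y))) by (intros; apply Hr). ring.
Qed.

Lemma filterlim_Re (u : nat -> C) (g : R) :
  filterlim u eventually (locally (RtoC g)) -> is_lim_seq (fun n => Re (u n)) g.
Proof.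
  intros H. apply is_lim_seq_spec. intros eps.
  assert (K := proj1 (filterlim_locally _ _) H eps). destruct K as [N HN].
  exists N; intros n Hn. destruct (HN n Hn) as [HB _]. exact HB.
Qed.

Lemma is_eisenstein_rectangular (Om s g2 g3 : R) :
  0 < Om -> 0 < s -> has_invariants (Om, 0) (0, s) g2 g3 ->
  let h := 2 * (PI * Om / s) in
  g2 / 60 = (PI / (2 * s)) ^ 4 * (eisQ h / 45) /\
  g3 / 140 = - (PI / (2 * s)) ^ 6 * (2 / 945 * eisR h).
Proof.
  intros HOm Hs [H4 H6] h. assert (HP := PI_RGT_0).
  set (y := PI * Om / s) in *.
  assert (Hy : 0 < y) by (unfold y; apply Rdiv_lt_0_compat; nra).
  assert (Hu : 2 * s / PI <> 0) by (apply Rgt_not_eq, Rdiv_lt_0_compat; lra).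
  assert (Pos : forall a b, 0 < a ^ 2 + b ^ 2 -> 0 < (2 * s / PI * b) ^ 2 + (2 * s / PI * a) ^ 2).
  { intros a b Hab. replace ((2 * s / PI * b) ^ 2 + (2 * s / PI * a) ^ 2)
      with ((2 * s / PI) ^ 2 * (a ^ 2 + b ^ 2)) by ring.
    apply Rmult_lt_0_compat; auto. apply pow2_gt_0; auto. }
  destruct (sum_over_rows y Hy) as [S4 S6].
  apply filterlim_Re in H4. apply filterlim_Re in H6.
  assert (Es : sre (PI / 2) 0 = 1).
  { unfold sre. rewrite sin_PI2, cos_PI2, cosh_0. ring. }
  assert (Ei : sim (PI / 2) 0 = 0).
  { unfold sim. rewrite cos_PI2. ring. }
  assert (C0 : c4 0 0 = 0 /\ c6 0 0 = 0).
  { unfold c4, c6, r4, r6, Rdiv. split; ring. }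
  assert (Z4 : is_series (fun n => c4 (INR (S n) * PI) 0)
     ((/ 2) ^ (4 + 2 * 0) * (1 / 3 / 2) / (1 - (/ 2) ^ (4 + 2 * 0)))).
  { apply (zeta_value c4 f4 0 (1 / 3)).
    - apply c_even.
    - apply c_bound.
    - intros x Hx. unfold c4, r4. simpl. field; auto.
    - apply is_series_row_4.
    - unfold f4, r4, r2. rewrite Es, Ei. field. }
  assert (Z6 : is_series (fun n => c6 (INR (S n) * PI) 0)
     ((/ 2) ^ (4 + 2 * 1) * (2 / 15 / 2) / (1 - (/ 2) ^ (4 + 2 * 1)))).
  { apply (zeta_value c6 f6 1 (2 / 15)).
    - apply c_even.
    - apply c_bound.
    - intros x Hx. unfold c6, r6. simpl. field; auto.
    - apply is_series_row_6.
    - unfold f6, r6, r4, r2. rewrite Es, Ei. field. }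
  assert (L4 := lattice_sum_limit c4 f4 0 ltac:(apply c_even) (proj1 C0) ltac:(apply c_bound)
    is_series_row_4 y _ _ Hy Z4 S4).
  assert (L6 := lattice_sum_limit c6 f6 1 ltac:(apply c_even) (proj2 C0) ltac:(apply c_bound)
    is_series_row_6 y _ _ Hy Z6 S6).
  assert (E4 : is_lim_seq (fun N => Re (eis_partial 4 (Om, 0) (0, s) N))
    ((PI / (2 * s)) ^ 4 * (2 * ((/ 2) ^ (4 + 2 * 0) * (1 / 3 / 2) / (1 - (/ 2) ^ (4 + 2 * 0)))
       + 2 * (8 / 3 * mom 3 (2 * y))))).
  { apply is_lim_seq_ext with (2 := is_lim_seq_mult' _ _ _ _ (is_lim_seq_const _) L4).
    intros N. symmetry. apply Re_eis_partial; try apply c_even; try apply C0; auto.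
    intros a b Hab. rewrite (proj1 (Re_Cinv_Cpow _ _ (Pos a b Hab))).
    rewrite (proj1 (c_rotate_scale _ _ _ Hu Hab)). f_equal. f_equal. field. lra. }
  assert (E6 : is_lim_seq (fun N => Re (eis_partial 6 (Om, 0) (0, s) N))
    (- (PI / (2 * s)) ^ 6 * (2 * ((/ 2) ^ (4 + 2 * 1) * (2 / 15 / 2) / (1 - (/ 2) ^ (4 + 2 * 1)))
       + 2 * (- (8 / 15) * mom 5 (2 * y))))).
  { apply is_lim_seq_ext with (2 := is_lim_seq_mult' _ _ _ _ (is_lim_seq_const _) L6).
    intros N. symmetry. apply Re_eis_partial; try apply c_even; try apply C0; auto.
    intros a b Hab. rewrite (proj2 (Re_Cinv_Cpow _ _ (Pos a b Hab))).
    rewrite (proj2 (c_rotate_scale _ _ _ Hu Hab)). f_equal. f_equal. f_equal. field. lra. }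
  apply is_lim_seq_unique in H4. apply is_lim_seq_unique in E4. rewrite H4 in E4.
  apply is_lim_seq_unique in H6. apply is_lim_seq_unique in E6. rewrite H6 in E6.
  injection E4 as E4. injection E6 as E6. rewrite E4, E6.
  unfold eisQ, eisR. fold h. split; simpl; field; lra.
Qed.

(** * The hypergeometric equation *)

Definition hyp_coef (n : nat) : R :=
  pochhammer (1/3) n * pochhammer (2/3) n / (pochhammer 1 n * INR (fact n)).

Definition F0 (x : R) : R := PSeries hyp_coef x.
Definition F1 (x : R) : R := PSeries (PS_derive hyp_coef) x.
Definition F2 (x : R) : R := PSeries (PS_derive (PS_derive hyp_coef)) x.

Lemma pochhammer_pos (a : R) (n : nat) : 0 < a -> 0 < pochhammer a n.
Proof.
  intros Ha; induction n as [|n IH]; simpl; [lra|].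
  apply Rmult_lt_0_compat; auto. assert (K := pos_INR n); lra.
Qed.

Lemma hyp_coef_S (n : nat) :
  hyp_coef (S n) * (INR n + 1) ^ 2 = hyp_coef n * (INR n + 1/3) * (INR n + 2/3).
Proof.
  unfold hyp_coef. cbn [pochhammer].
  replace (INR (fact (S n))) with ((INR n + 1) * INR (fact n)).
  2:{ rewrite <- S_INR, <- mult_INR; reflexivity. }
  assert (H1 := pochhammer_pos 1 n Rlt_0_1). assert (H2 := INR_fact_lt_0 n).
  assert (K := pos_INR n). field. repeat split; lra.
Qed.

Lemma hyp_coef_bounds (n : nat) : 0 < hyp_coef n <= 1.
Proof.
  induction n as [|n IH].
  - unfold hyp_coef; simpl. split; [lra|]. right; field.
  - assert (E := hyp_coef_S n). assert (K := pos_INR n).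
    assert (P : 0 < (INR n + 1) ^ 2) by (apply pow_lt; lra).
    split.
    + apply Rmult_lt_reg_r with ((INR n + 1) ^ 2); auto. rewrite E, Rmult_0_l.
      apply Rmult_lt_0_compat; [apply Rmult_lt_0_compat|]; lra.
    + apply Rmult_le_reg_r with ((INR n + 1) ^ 2); auto. rewrite E, Rmult_assoc.
      apply Rmult_le_compat; [lra | apply Rmult_le_pos; lra | lra | simpl; nra].
Qed.

Lemma hyp_coef_radius (x : R) : Rabs x < 1 -> Rbar_lt (Rabs x) (CV_radius hyp_coef).
Proof.
  intros Hx. apply Rbar_lt_le_trans with 1; [exact Hx|].
  apply (CV_radius_bounded hyp_coef). exists 1. intros n.
  rewrite pow1, Rmult_1_r. assert (H := hyp_coef_bounds n). rewrite Rabs_pos_eq; lra.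
Qed.

Lemma hyp2F1_F0 (x : R) : hyp2F1 (1/3) (2/3) 1 x = F0 x.
Proof. reflexivity. Qed.

Lemma is_derive_F0 (x : R) : Rabs x < 1 -> is_derive F0 x (F1 x).
Proof. intros H; apply is_derive_PSeries, hyp_coef_radius; auto. Qed.

Lemma is_derive_F1 (x : R) : Rabs x < 1 -> is_derive F1 x (F2 x).
Proof.
  intros H; apply is_derive_PSeries. rewrite CV_radius_derive. apply hyp_coef_radius; auto.
Qed.

Lemma F0_ge_1 (x : R) : 0 <= x < 1 -> 1 <= F0 x.
Proof.
  intros H. assert (E : 1 = psum (fun n => hyp_coef n * x ^ n) 1).
  { unfold hyp_coef; simpl; field. }
  rewrite E. apply psum_le_Series.
  - intros n. apply Rmult_le_pos; [left; apply hyp_coef_bounds | apply pow_le; lra].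
  - apply ex_series_Rabs, CV_disk_inside, hyp_coef_radius. rewrite Rabs_pos_eq; lra.
Qed.

Lemma F0_0 : F0 0 = 1.
Proof. unfold F0. rewrite PSeries_0. unfold hyp_coef; simpl; field. Qed.

Lemma is_series_PSeries (a : nat -> R) (x : R) :
  Rbar_lt (Rabs x) (CV_radius a) -> is_series (fun n => a n * x ^ n) (PSeries a x).
Proof. intros H. apply Series_correct, ex_series_Rabs, CV_disk_inside; auto. Qed.

(** The coefficient of x^n on the left is (n+1)^2 u_(n+1) - (n+1/3)(n+2/3) u_n, which vanishes by
    [hyp_coef_S]. *)
Lemma hypergeometric_equation (x : R) : Rabs x < 1 ->
  x * (1 - x) * F2 x + (1 - 2 * x) * F1 x - 2 / 9 * F0 x = 0.
Proof.
  intros Hx. assert (R0 := hyp_coef_radius x Hx).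
  set (u := hyp_coef) in *. set (d1 := PS_derive u). set (d2 := PS_derive d1).
  assert (R1 : Rbar_lt (Rabs x) (CV_radius d1)) by (unfold d1; rewrite CV_radius_derive; auto).
  assert (R2 : Rbar_lt (Rabs x) (CV_radius d2)) by (unfold d2; rewrite CV_radius_derive; auto).
  assert (I1 : Rbar_lt (Rabs x) (CV_radius (PS_incr_1 d1))) by (rewrite CV_radius_incr_1; auto).
  assert (I2 : Rbar_lt (Rabs x) (CV_radius (PS_incr_1 d2))) by (rewrite CV_radius_incr_1; auto).
  assert (I3 : Rbar_lt (Rabs x) (CV_radius (PS_incr_1 (PS_incr_1 d2))))
    by (rewrite !CV_radius_incr_1; auto).
  assert (S0 := is_series_PSeries _ _ R0). assert (S1 := is_series_PSeries _ _ R1).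
  assert (T1 := is_series_PSeries _ _ I1). assert (T2 := is_series_PSeries _ _ I2).
  assert (T3 := is_series_PSeries _ _ I3).
  rewrite PSeries_incr_1 in T1, T2. rewrite 2 PSeries_incr_1 in T3.
  change (PSeries d1 x) with (F1 x) in *. change (PSeries d2 x) with (F2 x) in *.
  change (PSeries u x) with (F0 x) in *.
  assert (Tot := is_series_minus _ _ _ _ (is_series_plus _ _ _ _ (is_series_minus _ _ _ _ T2 T3) S1)
    (is_series_plus _ _ _ _ (is_series_scal_l 2 _ _ T1) (is_series_scal_l (2 / 9) _ _ S0))).
  apply is_series_unique in Tot. revert Tot.
  rewrite (Series_ext _ (fun _ => 0)).
  - rewrite (Series_psum_eventually_zero (fun _ => 0) 0) by auto.
    unfold minus, plus, opp, scal; simpl. unfold mult; simpl. intros E. lra.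
  - intros n.
    assert (C1 : @eq R (PS_incr_1 d1 n) (INR n * u n)).
    { destruct n; [simpl; unfold zero; simpl; ring | reflexivity]. }
    assert (C2 : @eq R (PS_incr_1 d2 n) (INR n * ((INR n + 1) * u (S n)))).
    { destruct n; [simpl; unfold zero; simpl; ring|].
      unfold PS_incr_1, d2, d1, PS_derive. rewrite (S_INR (S n)). ring. }
    assert (C3 : @eq R (PS_incr_1 (PS_incr_1 d2) n) (INR n * (INR n - 1) * u n)).
    { destruct n as [|[|n]]; [simpl; unfold zero; simpl; ring .. |].
      unfold PS_incr_1, d2, d1, PS_derive. rewrite (S_INR (S n)). ring. }
    assert (C4 : d1 n = (INR n + 1) * u (S n)).
    { unfold d1, PS_derive. rewrite S_INR; auto. }
    rewrite C1, C2, C3, C4. unfold minus, plus, opp, scal; simpl. unfold mult; simpl.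
    assert (E := hyp_coef_S n). fold u in E.
    assert (E2 : ((INR n + 1) ^ 2 * u (S n) - (INR n + 1 / 3) * (INR n + 2 / 3) * u n) * x ^ n = 0).
    { rewrite Rmult_comm, (Rmult_comm _ (u (S n))), E. ring. }
    rewrite <- E2. field.
Qed.

(** * The modular parameter *)

(* [root_eq r c] says [r = (3 + 6 c^2 - c^4) / (8 c)]; along the family considered below
   [r = R / Q^(3/2)], and [c] is the coordinate in which [x] and [a] become rational in
   [sqrt Q]. *)
Definition root_eq (r c : R) : Prop := 1 < c < 3 /\ 8 * r * c = 3 + 6 * c ^ 2 - c ^ 4.

Lemma root_exists (r : R) : -1 < r < 1 -> {c : R | root_eq r c}.
Proof.
  intros Hr. destruct (IVT (fun c => c ^ 4 - 6 * c ^ 2 + 8 * r * c - 3) 1 3) as [c [Hc E]].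
  - intros c. apply derivable_continuous_pt. reg.
  - lra.
  - simpl; lra.
  - simpl; lra.
  - exists c. split; [|lra].
    assert (c <> 1) by (intros ->; simpl in E; lra).
    assert (c <> 3) by (intros ->; simpl in E; lra). lra.
Qed.

Definition root_of (r : R) : R :=
  match Rlt_dec (-1) r, Rlt_dec r 1 with
  | left H1, left H2 => proj1_sig (root_exists r (conj H1 H2))
  | _, _ => 1
  end.

Lemma root_of_spec (r : R) : -1 < r < 1 -> root_eq r (root_of r).
Proof.
  intros [H1 H2]. unfold root_of. destruct Rlt_dec; [|lra]. destruct Rlt_dec; [|lra].
  apply proj2_sig.
Qed.

(** The difference quotient of r = (3 + 6c^2 - c^4)/(8c), in a form that makes sense for c1 = c,
    where it equals - 3 (c^2 - 1)^2/(8 c^2). *)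
Definition slope (c1 c : R) : R := (6 - 3 / (c1 * c) - (c1 ^ 2 + c1 * c + c ^ 2)) / 8.

Lemma root_eq_diff (r r1 c c1 : R) :
  root_eq r c -> root_eq r1 c1 -> r1 - r = slope c1 c * (c1 - c).
Proof.
  intros [H E] [H1 E1].
  replace r with ((3 + 6 * c ^ 2 - c ^ 4) / (8 * c)) by (rewrite <- E; field; lra).
  replace r1 with ((3 + 6 * c1 ^ 2 - c1 ^ 4) / (8 * c1)) by (rewrite <- E1; field; lra).
  unfold slope. field; lra.
Qed.

(** With p = c1 c the slope is at most - (3/8)(p + 1/p - 2), and p >= c > 1 makes the bracket at
    least (c - 1)^2/c. Being uniform in c1, the bound gives uniqueness of the root, continuity of
    the inverse and a nonzero derivative. *)
Lemma slope_le (c1 c : R) : 1 < c < 3 -> 1 < c1 < 3 -> slope c1 c <= - (3 / 8 * (c - 1) ^ 2 / c).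
Proof.
  intros H H1. unfold slope.
  assert (Hp : c <= c1 * c) by nra. set (p := c1 * c) in *.
  assert (3 * p <= c1 ^ 2 + p + c ^ 2).
  { assert (0 <= (c1 - c) ^ 2) by apply pow2_ge_0. unfold p. simpl in *. lra. }
  assert (K : (c - 1) ^ 2 / c <= p + / p - 2).
  { replace ((c - 1) ^ 2 / c) with (c + / c - 2) by (field; lra).
    assert (/ c - / p = (p - c) * (/ c * / p)) by (field; lra).
    assert (0 < / c * / p <= 1).
    { split; [apply Rmult_lt_0_compat; apply Rinv_0_lt_compat; lra|].
      rewrite <- Rinv_mult, <- Rinv_1. apply Rinv_le_contravar; nra. }
    nra. }
  replace (3 / 8 * (c - 1) ^ 2 / c) with (3 / 8 * ((c - 1) ^ 2 / c)) by (field; lra).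
  replace (3 / p) with (3 * / p) by reflexivity. lra.
Qed.

Lemma root_eq_unique (r c c1 : R) : root_eq r c -> root_eq r c1 -> c1 = c.
Proof.
  intros H H1. assert (E := root_eq_diff r r c c1 H H1).
  assert (S := slope_le c1 c (proj1 H) (proj1 H1)).
  assert (0 < 3 / 8 * (c - 1) ^ 2 / c).
  { destruct H as [H _]. apply Rdiv_lt_0_compat; [|lra].
    apply Rmult_lt_0_compat; [lra|]. apply pow_lt; lra. }
  apply Rminus_diag_uniq. rewrite Rminus_eq_0 in E. symmetry in E.
  apply Rmult_integral in E. destruct E; lra.
Qed.

Lemma root_of_continuous (r : R) : -1 < r < 1 -> continuity_pt root_of r.
Proof.
  intros Hr eps Heps. assert (Sp := root_of_spec r Hr). set (c := root_of r) in *.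
  destruct (proj1 Sp) as [Hc1 Hc3].
  set (k := 3 / 8 * (c - 1) ^ 2 / c).
  assert (Hk : 0 < k).
  { unfold k. apply Rdiv_lt_0_compat; [|lra].
    apply Rmult_lt_0_compat; [lra|]. apply pow_lt; lra. }
  exists (Rmin (k * eps) (Rmin (1 - r) (r + 1))). split.
  { repeat apply Rmin_pos; try lra. apply Rmult_lt_0_compat; auto. }
  intros t [_ Ht]. unfold dist in *; simpl in Ht |- *; unfold Rdist in *.
  assert (T1 := Rlt_le_trans _ _ _ Ht (Rmin_l _ _)).
  assert (T2 := Rlt_le_trans _ _ _ Ht (Rmin_r _ _)).
  assert (T3 := Rlt_le_trans _ _ _ T2 (Rmin_l _ _)).
  assert (T4 := Rlt_le_trans _ _ _ T2 (Rmin_r _ _)).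
  assert (Ht1 : -1 < t < 1).
  { apply Rabs_def2 in T3. apply Rabs_def2 in T4. lra. }
  assert (Sp1 := root_of_spec t Ht1).
  assert (E := root_eq_diff _ _ _ _ Sp Sp1).
  assert (S := slope_le _ _ (proj1 Sp) (proj1 Sp1)). fold k in S.
  assert (Hn : slope (root_of t) c < 0) by lra.
  rewrite E, Rabs_mult, (Rabs_left _ Hn) in T1.
  fold c in T1 |- *. set (z := Rabs (root_of t - c)) in *.
  assert (0 <= z) by apply Rabs_pos.
  apply Rmult_lt_reg_l with k; auto. nra.
Qed.

(** The difference quotient of the inverse is exactly [/ slope]; its limit is the continuity of
    [slope] in c1 composed with that of [root_of]. *)
Lemma is_derive_root_of (r : R) : -1 < r < 1 ->
  is_derive root_of r (/ slope (root_of r) (root_of r)).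
Proof.
  intros Hr. assert (Sp := root_of_spec r Hr). set (c := root_of r) in *.
  assert (Hc := proj1 Sp).
  assert (Hneg : forall c1, 1 < c1 < 3 -> slope c1 c < 0).
  { intros c1 H1. assert (S := slope_le c1 c Hc H1).
    assert (0 < 3 / 8 * (c - 1) ^ 2 / c).
    { apply Rdiv_lt_0_compat; [|lra]. apply Rmult_lt_0_compat; [lra|]. apply pow_lt; lra. }
    lra. }
  assert (HC : continuity_pt (comp (fun c1 => / slope c1 c) root_of) r).
  { apply continuity_pt_comp; [apply root_of_continuous; auto|]. fold c.
    apply derivable_continuous_pt.
    assert (D : ex_derive (fun c1 => / slope c1 c) c).
    { unfold slope. auto_derive. repeat split; try lra.
      - nra.
      - specialize (Hneg c Hc). unfold slope in Hneg. simpl in Hneg. lra. }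
    apply ex_derive_Reals_0; exact D. }
  apply is_derive_Reals. intros eps Heps.
  destruct (HC eps Heps) as [del [Hd HD]].
  assert (Hm : 0 < Rmin del (Rmin (1 - r) (r + 1))).
  { repeat apply Rmin_pos; lra. }
  exists (mkposreal _ Hm). simpl. intros e He0 He.
  assert (T1 := Rlt_le_trans _ _ _ He (Rmin_l _ _)).
  assert (T2 := Rlt_le_trans _ _ _ He (Rmin_r _ _)).
  assert (T3 := Rlt_le_trans _ _ _ T2 (Rmin_l _ _)).
  assert (T4 := Rlt_le_trans _ _ _ T2 (Rmin_r _ _)).
  assert (Ht1 : -1 < r + e < 1).
  { apply Rabs_def2 in T3. apply Rabs_def2 in T4. lra. }
  assert (Sp1 := root_of_spec _ Ht1).
  assert (E := root_eq_diff _ _ _ _ Sp Sp1). replace (r + e - r) with e in E by ring.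
  assert (HS := Hneg _ (proj1 Sp1)).
  assert (Q : (root_of (r + e) - root_of r) / e = / slope (root_of (r + e)) c).
  { fold c. apply Rmult_eq_reg_r with e; auto. unfold Rdiv. rewrite Rmult_assoc, Rinv_l by auto.
    clear - E HS. set (d := root_of (r + e)) in *. clearbody d.
    rewrite Rmult_1_r, E. field. lra. }
  rewrite Q. unfold comp in HD.
  specialize (HD (r + e)). unfold dist in HD; simpl in HD; unfold Rdist in HD. fold c in HD.
  apply HD. split.
  - unfold D_x, no_cond. split; auto. intros K. apply He0. lra.
  - replace (r + e - r) with e by ring. auto.
Qed.

(** (c - 1)^3 (c + 3) = 8 c (1 - r), and 8c <= 4 (c + 3) for c < 3. The root becomes triple at r =
    1, the end point where the bound on [slope] degenerates. *)
Lemma root_eq_near_1 (r c : R) : root_eq r c -> (c - 1) ^ 3 <= 4 * (1 - r).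
Proof.
  intros [H E].
  assert (E2 : (c - 1) ^ 3 * (c + 3) = 8 * c * (1 - r)).
  { replace (8 * c * (1 - r)) with (8 * c - 8 * r * c) by ring. rewrite E. ring. }
  assert (P : 0 < (c - 1) ^ 3) by (apply pow_lt; lra).
  assert (0 < 1 - r) by nra.
  apply Rmult_le_reg_r with (c + 3); [lra|]. rewrite E2. nra.
Qed.

Ltac rewrite_derive D :=
  match type of D with is_derive ?f ?x ?l =>
    try change (Derive (fun t => f t) x) with (Derive f x);
    rewrite (is_derive_unique f x l D)
  end.

(** * Behaviour as h tends to infinity *)

Lemma mom_ge_0 (i : nat) (h : R) : 0 < h -> 0 <= mom i h.
Proof.
  intros Hh. apply (psum_le_Series (fun a => INR a ^ i * lam a h) 0).
  - intros n. apply Rmult_le_pos; [apply pow_le, pos_INR | apply lam_ge_0; auto].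
  - apply ex_series_mom; auto.
Qed.

(** The integers suffice as a path to infinity, since the limits will only serve to identify
    constants; h >= 1 provides the common majorant. *)
Lemma is_lim_seq_mom (i : nat) : is_lim_seq (fun n => mom (S i) (INR (S n))) 0.
Proof.
  destruct (exp_neg_lt_1 1 Rlt_0_1) as [E0 E1].
  assert (H1 : forall n, 0 < 1 <= INR (S n)).
  { intros n. rewrite S_INR. assert (K := pos_INR n). lra. }
  replace 0 with (Series (fun _ => 0)).
  2:{ rewrite (Series_psum_eventually_zero (fun _ => 0) 0); auto. }
  apply (filterlim_Series_dominated eventually
    (fun n a => INR a ^ S i * lam a (INR (S n))) _ _ (ex_series_bound (S i) 1 1 Rlt_0_1)).
  - apply filter_forall. intros n a.
    destruct (lam_pow_bound (S i) 1 a 1 (INR (S n)) (H1 n) ltac:(auto)) as [B1 B2].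
    rewrite (pow_1 (lam a _)) in B1, B2. rewrite Rabs_pos_eq; auto.
  - intros a. change (is_lim_seq (fun n => INR a ^ S i * lam a (INR (S n))) 0).
    destruct a as [|a].
    { apply is_lim_seq_ext with (fun _ => 0); [intros; rewrite lam_0; ring | apply is_lim_seq_const]. }
    assert (L : is_lim_seq (fun n => / (1 - exp (- (1))) * exp (- (1)) ^ S n) 0).
    { replace 0 with (/ (1 - exp (- (1))) * 0) by ring.
      apply is_lim_seq_mult'; [apply is_lim_seq_const|].
      apply (is_lim_seq_incr_1 (fun n => exp (- (1)) ^ n)).
      apply is_lim_seq_geom. rewrite Rabs_pos_eq; lra. }
    replace 0 with (INR (S a) ^ S i * 0) by ring.
    apply is_lim_seq_mult'; [apply is_lim_seq_const|].
    apply is_lim_seq_le_le with (u := fun _ => 0) (w := fun n => / (1 - exp (- (1))) * exp (- (1)) ^ S n);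
      [|apply is_lim_seq_const|exact L].
    intros n. split; [apply lam_ge_0; specialize (H1 n); lra|].
    eapply Rle_trans; [apply (lam_le _ 1 _ (H1 n))|]. unfold Rdiv. rewrite Rmult_comm.
    apply Rmult_le_compat_l; [left; apply Rinv_0_lt_compat; lra|].
    replace (exp (- (1)) ^ S n) with (exp (- INR (S n))).
    2:{ rewrite <- exp_INR_mul. f_equal; ring. }
    assert (0 < exp (- INR (S n)) < 1) by (apply exp_neg_lt_1; specialize (H1 n); lra).
    set (w := exp (- INR (S n))) in *. change (w ^ S a) with (w * w ^ a).
    assert (w ^ a <= 1) by (rewrite <- (pow1 a); apply pow_incr; lra). nra.
Qed.

Lemma is_lim_seq_eis :
  is_lim_seq (fun n => eisP (INR (S n))) 1 /\ is_lim_seq (fun n => eisQ (INR (S n))) 1 /\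
  is_lim_seq (fun n => eisR (INR (S n))) 1.
Proof.
  assert (G : forall c i, is_lim_seq (fun n => 1 + c * mom (S i) (INR (S n))) 1).
  { intros c i. replace (Finite 1) with (Finite (1 + c * 0)) by (f_equal; ring).
    apply is_lim_seq_plus'; [apply is_lim_seq_const|].
    apply is_lim_seq_mult'; [apply is_lim_seq_const | apply is_lim_seq_mom]. }
  repeat split.
  - apply is_lim_seq_ext with (2 := G (-24) 0%nat). intros; unfold eisP; ring.
  - apply (G 240 2%nat).
  - apply is_lim_seq_ext with (2 := G (-504) 4%nat). intros; unfold eisR; ring.
Qed.

Lemma eisQ_pos (h : R) : 0 < h -> 0 < eisQ h.
Proof. intros Hh. unfold eisQ. assert (K := mom_ge_0 3 h Hh). lra. Qed.

Lemma eisP_le_1 (h : R) : 0 < h -> eisP h <= 1.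
Proof. intros Hh. unfold eisP. assert (K := mom_ge_0 1 h Hh). lra. Qed.

Lemma is_derive_nonneg_le (f df : R -> R) (a b : R) :
  a <= b -> (forall t, a <= t <= b -> is_derive f t (df t)) ->
  (forall t, a <= t <= b -> 0 <= df t) -> f a <= f b.
Proof.
  intros Hab D P. destruct (MVT_gen f a b df) as [c [Hc E]].
  - intros t Ht. apply D. rewrite Rmin_left, Rmax_right in Ht; lra.
  - intros t Ht. rewrite Rmin_left, Rmax_right in Ht by lra.
    apply derivable_continuous_pt, ex_derive_Reals_0. exists (df t). auto.
  - rewrite Rmin_left, Rmax_right in Hc by lra. specialize (P c Hc). nra.
Qed.

Lemma is_derive_zero_eq (f : R -> R) (a b : R) :
  a <= b -> (forall t, a <= t <= b -> is_derive f t 0) -> f a = f b.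
Proof.
  intros Hab D. apply Rle_antisym.
  - apply (is_derive_nonneg_le f (fun _ => 0)); auto; intros; lra.
  - apply Ropp_le_cancel. apply (is_derive_nonneg_le (fun t => - f t) (fun _ => 0)); auto.
    + intros t Ht. replace 0 with (- 0) by ring. apply (is_derive_opp f). auto.
    + intros; lra.
Qed.

Lemma continuity_pt_is_derive (f : R -> R) (x l : R) : is_derive f x l -> continuity_pt f x.
Proof. intros H. apply derivable_continuous_pt, ex_derive_Reals_0. exists l; auto. Qed.

(** 1728 times the modular discriminant. As Q > 0, it is positive exactly when R/Q^(3/2) lies in
    (-1, 1), the domain of the inversion. *)
Definition disc (h : R) : R := eisQ h ^ 3 - eisR h ^ 2.

Lemma is_derive_disc (h : R) : 0 < h -> is_derive disc h (- (eisP h * disc h)).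
Proof.
  intros Hh. assert (DQ := is_derive_eisQ h Hh). assert (DR := is_derive_eisR h Hh).
  unfold disc. auto_derive.
  - repeat split; [exists (- (eisP h * eisQ h - eisR h) / 3); exact DQ
                  |exists (- (eisP h * eisR h - eisQ h ^ 2) / 2); exact DR].
  - rewrite_derive DQ; rewrite_derive DR. simpl; field.
Qed.

(* As [P <= 1], the function [disc^2 e^(2h)] is nondecreasing, so [disc] has no zero. *)
Lemma disc_pos (h0 h : R) : 0 < h0 <= h -> 0 < disc h0 -> 0 < disc h.
Proof.
  intros H H0.
  assert (N : forall t, h0 <= t -> disc t <> 0).
  { intros t Ht E.
    assert (K := is_derive_nonneg_le (fun u => disc u ^ 2 * exp (2 * u))
      (fun u => 2 * (1 - eisP u) * (disc u ^ 2 * exp (2 * u))) h0 t Ht).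
    cut (disc h0 ^ 2 * exp (2 * h0) <= disc t ^ 2 * exp (2 * t)).
    - rewrite E. assert (0 < disc h0 ^ 2 * exp (2 * h0)).
      { apply Rmult_lt_0_compat; [apply pow_lt; auto | apply exp_pos]. } lra.
    - apply K.
      + intros u Hu. assert (D := is_derive_disc u ltac:(lra)). auto_derive.
        * exists (- (eisP u * disc u)); exact D.
        * rewrite_derive D. ring.
      + intros u Hu. assert (L := eisP_le_1 u ltac:(lra)). apply Rmult_le_pos; [lra|].
        apply Rmult_le_pos; [apply pow2_ge_0 | left; apply exp_pos]. }
  destruct (Rlt_le_dec 0 (disc h)) as [|Hn]; auto. exfalso.
  assert (Hh : disc h < 0) by (destruct Hn; auto; exfalso; apply (N h); lra).
  assert (Hlt : h0 < h) by (destruct (proj2 H); auto; subst; lra).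
  destruct (Ranalysis5.IVT_interv (fun t => - disc t) h0 h) as [z [Hz E]]; try lra.
  - intros t Ht. apply continuity_pt_opp.
    apply (continuity_pt_is_derive _ _ _ (is_derive_disc t ltac:(lra))).
  - apply (N z); lra.
Qed.

(** * The parametrization as a function of h *)

Definition sqQ (h : R) : R := sqrt (eisQ h).
Definition modc (h : R) : R := root_of (eisR h / sqQ h ^ 3).
(** 1 - 8x/9 = 1/c^2 turns Q = a^4 (1 - 8x/9) into a^2 = c sqrt Q; this is a^2. *)
Definition modA (h : R) : R := modc h * sqQ h.
Definition moda (h : R) : R := sqrt (modA h).
Definition modx (h : R) : R := 9 / 8 * (1 - / modc h ^ 2).

Lemma sqQ_spec (h : R) : 0 < h -> 0 < sqQ h /\ sqQ h ^ 2 = eisQ h.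
Proof.
  intros Hh. assert (K := eisQ_pos h Hh). split; [apply sqrt_lt_R0; auto|].
  unfold sqQ. simpl. rewrite Rmult_1_r. apply sqrt_sqrt; lra.
Qed.

Lemma ratio_bounds (h : R) : 0 < h -> 0 < disc h -> -1 < eisR h / sqQ h ^ 3 < 1.
Proof.
  intros Hh Hd. destruct (sqQ_spec h Hh) as [Q0 Q1]. unfold disc in Hd. rewrite <- Q1 in Hd.
  assert (Q3 : 0 < sqQ h ^ 3) by (apply pow_lt; auto).
  replace ((sqQ h ^ 2) ^ 3) with ((sqQ h ^ 3) ^ 2) in Hd by ring.
  assert (Hb : - sqQ h ^ 3 < eisR h < sqQ h ^ 3).
  { split; simpl in *; nra. }
  split; (apply Rmult_lt_reg_r with (sqQ h ^ 3); auto; unfold Rdiv;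
    rewrite Rmult_assoc, Rinv_l by lra; lra).
Qed.

Lemma modc_spec (h : R) : 0 < h -> 0 < disc h ->
  1 < modc h < 3 /\ eisR h = sqQ h ^ 3 * ((3 + 6 * modc h ^ 2 - modc h ^ 4) / (8 * modc h)).
Proof.
  intros Hh Hd. destruct (root_of_spec _ (ratio_bounds h Hh Hd)) as [H1 H2].
  fold (modc h) in *. split; auto. rewrite <- H2. destruct (sqQ_spec h Hh).
  field. split; lra.
Qed.

Lemma is_derive_sqQ (h : R) : 0 < h ->
  is_derive sqQ h (- (eisP h * eisQ h - eisR h) / (6 * sqQ h)).
Proof.
  intros Hh. destruct (sqQ_spec h Hh).
  assert (D := is_derive_sqrt _ _ _ (is_derive_eisQ h Hh) (eisQ_pos h Hh)).
  fold (sqQ h) in D.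
  replace (- (eisP h * eisQ h - eisR h) / (6 * sqQ h)) with
    (- (eisP h * eisQ h - eisR h) / 3 / (2 * sqQ h)) by (field; lra). exact D.
Qed.

(** The ratio r = R/Q^(3/2) has weight 0, so P drops out: r' = sqrt Q (1 - r^2)/2. In terms of c, 1
    - r^2 = (c^2 - 1)^3 (9 - c^2)/(64 c^2), and division by the slope at c lowers the exponent 3 to
    1. *)
Lemma is_derive_modc (h : R) : 0 < h -> 0 < disc h ->
  is_derive modc h (- (sqQ h * (modc h ^ 2 - 1) * (9 - modc h ^ 2) / 48)).
Proof.
  intros Hh Hd. destruct (sqQ_spec h Hh) as [Q0 Q1].
  destruct (modc_spec h Hh Hd) as [Hc ER].
  assert (DQ := is_derive_sqQ h Hh). assert (DR := is_derive_eisR h Hh).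
  assert (Dr : is_derive (fun t => eisR t / sqQ t ^ 3) h
    (sqQ h * (1 - (eisR h / sqQ h ^ 3) ^ 2) / 2)).
  { auto_derive.
    - repeat split; [eexists; exact DR | eexists; exact DQ |].
      assert (0 < sqQ h ^ 3) by (apply pow_lt; auto). simpl in *; lra.
    - rewrite_derive DQ; rewrite_derive DR; rewrite <- Q1. field. lra. }
  assert (D := is_derive_comp (V := R_NormedModule) root_of
    (fun t => eisR t / sqQ t ^ 3) h _ _ (is_derive_root_of _ (ratio_bounds h Hh Hd)) Dr).
  fold (modc h) in D.
  assert (N1 : modc h ^ 2 - 1 <> 0) by (simpl; nra).
  replace (- (sqQ h * (modc h ^ 2 - 1) * (9 - modc h ^ 2) / 48)) with
    (scal (sqQ h * (1 - (eisR h / sqQ h ^ 3) ^ 2) / 2) (/ slope (modc h) (modc h))).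
  - exact D.
  - unfold scal; simpl; unfold mult; simpl. rewrite ER.
    replace (slope (modc h) (modc h)) with (- (3 * (modc h ^ 2 - 1) ^ 2 / (8 * modc h ^ 2)))
      by (unfold slope; field; lra).
    field. repeat split; lra.
Qed.

Lemma mod_facts (h : R) : 0 < h -> 0 < disc h ->
  0 < moda h /\ moda h ^ 2 = modA h /\ 0 < modx h < 1 /\
  eisQ h = moda h ^ 4 * (1 - 8 / 9 * modx h).
Proof.
  intros Hh Hd. destruct (sqQ_spec h Hh) as [Q0 Q1].
  destruct (modc_spec h Hh Hd) as [Hc _].
  assert (A0 : 0 < modA h) by (apply Rmult_lt_0_compat; lra).
  assert (a0 : 0 < moda h) by (apply sqrt_lt_R0; auto).
  assert (a2 : moda h ^ 2 = modA h) by (unfold moda; simpl; rewrite Rmult_1_r; apply sqrt_sqrt; lra).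
  repeat split; auto.
  - unfold modx. assert (/ modc h ^ 2 < 1).
    { rewrite <- Rinv_1. apply Rinv_lt_contravar; simpl; nra. } lra.
  - unfold modx. assert (/ 9 < / modc h ^ 2).
    { apply Rinv_lt_contravar; simpl; nra. } lra.
  - replace (moda h ^ 4) with (moda h ^ 2 * moda h ^ 2) by ring. rewrite a2, <- Q1.
    unfold modA, modx. field. lra.
Qed.

Lemma is_derive_modx (h : R) : 0 < h -> 0 < disc h ->
  is_derive modx h (- (moda h ^ 2 * modx h * (1 - modx h) / 3)).
Proof.
  intros Hh Hd. destruct (mod_facts h Hh Hd) as [_ [-> _]].
  destruct (modc_spec h Hh Hd) as [Hc _].
  assert (D := is_derive_modc h Hh Hd). unfold modx, modA. auto_derive.
  - repeat split; [eexists; exact D|]. simpl; nra.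
  - rewrite_derive D. field. lra.
Qed.

Lemma is_derive_moda (h : R) : 0 < h -> 0 < disc h ->
  is_derive moda h (- (moda h * (eisP h - moda h ^ 2 * (1 - 4 / 3 * modx h)) / 12)).
Proof.
  intros Hh Hd. destruct (mod_facts h Hh Hd) as [a0 [a2 _]].
  destruct (modc_spec h Hh Hd) as [Hc ER]. destruct (sqQ_spec h Hh) as [Q0 Q1].
  assert (A0 : 0 < modA h) by (apply Rmult_lt_0_compat; lra).
  assert (DA : is_derive modA h (- (modA h * (eisP h - modA h * (1 - 4 / 3 * modx h)) / 6))).
  { assert (D := is_derive_modc h Hh Hd). assert (DQ := is_derive_sqQ h Hh).
    unfold modA. auto_derive.
    - repeat split; [eexists; exact D | eexists; exact DQ].
    - rewrite_derive D; rewrite_derive DQ; rewrite <- Q1, ER.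
      unfold modx. field. lra. }
  assert (D := is_derive_sqrt _ _ _ DA A0). fold (moda h) in D.
  replace (- (moda h * (eisP h - moda h ^ 2 * (1 - 4 / 3 * modx h)) / 12)) with
    (- (modA h * (eisP h - modA h * (1 - 4 / 3 * modx h)) / 6) / (2 * moda h)); [exact D|].
  rewrite <- a2. field. lra.
Qed.

(* The Wronskian of [moda] and [F0 o modx], up to the factor that makes it constant. *)
Definition wronsk (h : R) : R :=
  - F0 (modx h) * (eisP h - moda h ^ 2 * (1 - 4 / 3 * modx h)) / (12 * moda h)
  + F1 (modx h) * moda h * modx h * (1 - modx h) / 3.

(** With F = F0 o [modx], [wronsk] is (a' F - a F')/a^2. In its derivative F2 occurs only with the
    factor x (1 - x), and the whole is a multiple of the hypergeometric equation. *)
Lemma is_derive_wronsk (h : R) : 0 < h -> 0 < disc h -> is_derive wronsk h 0.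
Proof.
  intros Hh Hd. destruct (mod_facts h Hh Hd) as [a0 [_ [Hx EQ]]].
  assert (Da := is_derive_moda h Hh Hd). assert (Dx := is_derive_modx h Hh Hd).
  assert (DP := is_derive_eisP h Hh).
  assert (Hxa : Rabs (modx h) < 1) by (rewrite Rabs_pos_eq; lra).
  assert (D0 := is_derive_F0 _ Hxa). assert (D1 := is_derive_F1 _ Hxa).
  assert (HE := hypergeometric_equation _ Hxa).
  unfold wronsk. auto_derive.
  - repeat split; try (eexists; eassumption); try lra.
  - rewrite_derive Da; rewrite_derive Dx; rewrite_derive DP; rewrite_derive D0; rewrite_derive D1; rewrite EQ.
    set (x := modx h) in *. set (a := moda h) in *. set (P := eisP h) in *.
    assert (E2 : F2 x * (x * (1 - x)) = 2 / 9 * F0 x - (1 - 2 * x) * F1 x) by lra.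
    transitivity (- (a ^ 3 * x * (1 - x) / 9)
      * (F2 x * (x * (1 - x)) - (2 / 9 * F0 x - (1 - 2 * x) * F1 x))).
    + field. lra.
    + rewrite E2. ring.
Qed.

Lemma is_derive_quotient (h : R) : 0 < h -> 0 < disc h ->
  is_derive (fun t => moda t / F0 (modx t)) h (moda h ^ 2 * wronsk h / F0 (modx h) ^ 2).
Proof.
  intros Hh Hd. destruct (mod_facts h Hh Hd) as [a0 [_ [Hx EQ]]].
  assert (Da := is_derive_moda h Hh Hd). assert (Dx := is_derive_modx h Hh Hd).
  assert (Hxa : Rabs (modx h) < 1) by (rewrite Rabs_pos_eq; lra).
  assert (D0 := is_derive_F0 _ Hxa). assert (F0g := F0_ge_1 (modx h) ltac:(lra)).
  unfold wronsk. auto_derive.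
  - repeat split; try (eexists; eassumption); lra.
  - rewrite_derive Da; rewrite_derive Dx; rewrite_derive D0.
    field. split; lra.
Qed.

(** The limit r = 1 is outside the range of continuity of [root_of]; the cubic estimate replaces it,
    as 1 - r < eps^3/4 forces c - 1 < eps. *)
Lemma is_lim_seq_modc :
  (exists N, forall n, (N <= n)%nat -> 0 < disc (INR (S n))) ->
  is_lim_seq (fun n => modc (INR (S n))) 1 /\ is_lim_seq (fun n => sqQ (INR (S n))) 1.
Proof.
  intros [N HN]. destruct is_lim_seq_eis as [_ [LQ LR]].
  assert (Lq : is_lim_seq (fun n => sqQ (INR (S n))) 1).
  { rewrite <- sqrt_1. apply (is_lim_seq_continuous sqrt); auto.
    apply continuity_pt_sqrt; lra. }
  split; auto.
  assert (Lr : is_lim_seq (fun n => eisR (INR (S n)) / sqQ (INR (S n)) ^ 3) 1).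
  { replace (Finite 1) with (Finite (1 / 1 ^ 3)) by (f_equal; field).
    apply is_lim_seq_div'; auto; [|simpl; lra]. apply is_lim_seq_pow; auto. }
  apply is_lim_seq_spec in Lr. apply is_lim_seq_spec. intros eps.
  assert (He : 0 < eps ^ 3 / 4) by (assert (K := pow_lt eps 3 (cond_pos eps)); lra).
  destruct (Lr (mkposreal _ He)) as [M HM]. simpl in HM.
  exists (Nat.max N M). intros n Hn.
  specialize (HM n ltac:(lia)). specialize (HN n ltac:(lia)).
  assert (Hp : 0 < INR (S n)) by (apply lt_0_INR; lia).
  assert (Sp := root_of_spec _ (ratio_bounds _ Hp HN)). fold (modc (INR (S n))) in Sp.
  assert (B := root_eq_near_1 _ _ Sp). destruct Sp as [Hc _].
  set (c := modc (INR (S n))) in *. rewrite Rabs_pos_eq by lra.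
  destruct (Rlt_le_dec (c - 1) eps) as [|Hge]; auto. exfalso.
  assert (K : eps ^ 3 <= (c - 1) ^ 3) by (apply pow_incr; split; auto; left; apply cond_pos).
  apply Rabs_def2 in HM. simpl in K, B, HM. lra.
Qed.

(** On [h0, oo) two constants are identified by their limits: the Wronskian by 0, which excludes a
    share of the logarithmic solution, and then the quotient of [moda] and F0 o [modx] by 1. *)
Lemma moda_eq_F0 (h0 : R) : 0 < h0 -> 0 < disc h0 -> moda h0 = F0 (modx h0).
Proof.
  intros Hh Hd.
  assert (HN : exists N, forall n, (N <= n)%nat -> h0 <= INR (S n)).
  { destruct (nfloor_ex h0 ltac:(lra)) as [N [_ HN]]. exists N. intros n Hn.
    rewrite S_INR. assert (K := le_INR _ _ Hn). lra. }
  assert (Dp : forall t, h0 <= t -> 0 < disc t) by (intros t Ht; apply (disc_pos h0); auto; lra).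
  destruct HN as [N HN].
  destruct is_lim_seq_modc as [Lc Lq]; [exists N; auto|].
  destruct is_lim_seq_eis as [LP _].
  assert (La : is_lim_seq (fun n => moda (INR (S n))) 1).
  { rewrite <- sqrt_1. apply (is_lim_seq_continuous sqrt); [apply continuity_pt_sqrt; lra|].
    replace (Finite 1) with (Finite (1 * 1)) by (f_equal; ring). apply is_lim_seq_mult'; auto. }
  assert (Lx : is_lim_seq (fun n => modx (INR (S n))) 0).
  { replace (Finite 0) with (Finite (9 / 8 * (1 - 1 / 1 ^ 2))) by (f_equal; field).
    apply is_lim_seq_ext with (fun n => 9 / 8 * (1 - 1 / modc (INR (S n)) ^ 2)).
    { intros n; unfold modx, Rdiv. rewrite !Rmult_1_l; auto. }
    apply is_lim_seq_mult'; [apply is_lim_seq_const|].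
    apply is_lim_seq_minus'; [apply is_lim_seq_const|].
    apply is_lim_seq_div'; [apply is_lim_seq_const | apply is_lim_seq_pow; auto | simpl; lra]. }
  assert (Z : Rabs 0 < 1) by (rewrite Rabs_R0; lra).
  assert (LF0 : is_lim_seq (fun n => F0 (modx (INR (S n)))) 1).
  { rewrite <- F0_0. apply (is_lim_seq_continuous F0); auto.
    apply (continuity_pt_is_derive _ _ _ (is_derive_F0 0 Z)). }
  assert (LF1 : is_lim_seq (fun n => F1 (modx (INR (S n)))) (F1 0)).
  { apply (is_lim_seq_continuous F1); auto.
    apply (continuity_pt_is_derive _ _ _ (is_derive_F1 0 Z)). }
  assert (LW : is_lim_seq (fun n => wronsk (INR (S n))) 0).
  { replace (Finite 0) with (Finite (- (1) * (1 - 1 ^ 2 * (1 - 4 / 3 * 0)) / (12 * 1)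
      + F1 0 * 1 * 0 * (1 - 0) / 3)) by (f_equal; field).
    unfold wronsk, Rdiv. apply is_lim_seq_plus'.
    - apply is_lim_seq_div'; [|apply is_lim_seq_mult'; auto; apply is_lim_seq_const|lra].
      apply is_lim_seq_mult'; [apply (is_lim_seq_opp _ 1); auto|].
      apply is_lim_seq_minus'; auto. apply is_lim_seq_mult'; [apply is_lim_seq_pow; auto|].
      apply is_lim_seq_minus'; [apply is_lim_seq_const|].
      apply is_lim_seq_mult'; auto; apply is_lim_seq_const.
    - apply is_lim_seq_mult'; [|apply is_lim_seq_const].
      repeat apply is_lim_seq_mult'; auto.
      apply is_lim_seq_minus'; auto; apply is_lim_seq_const. }
  assert (W0 : forall t, h0 <= t -> wronsk t = 0).
  { assert (Wc : forall t, h0 <= t -> wronsk h0 = wronsk t).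
    { intros t Ht. apply is_derive_zero_eq; auto. intros u Hu. apply is_derive_wronsk; [lra|].
      apply Dp; lra. }
    assert (C : is_lim_seq (fun n => wronsk (INR (S n))) (wronsk h0)).
    { apply is_lim_seq_ext_loc with (fun _ => wronsk h0); [|apply is_lim_seq_const].
      exists N; intros n Hn. apply Wc; auto. }
    apply is_lim_seq_unique in C. apply is_lim_seq_unique in LW. rewrite LW in C.
    injection C as C. intros t Ht. rewrite <- Wc; auto. }
  assert (Qc : forall t, h0 <= t -> moda h0 / F0 (modx h0) = moda t / F0 (modx t)).
  { intros t Ht. apply (is_derive_zero_eq (fun t => moda t / F0 (modx t))); auto.
    intros u Hu. assert (D := is_derive_quotient u ltac:(lra) (Dp u ltac:(lra))).
    rewrite W0 in D by lra.
    replace (moda u ^ 2 * 0 / F0 (modx u) ^ 2) with 0 in D by (unfold Rdiv; ring). exact D. }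
  assert (LQ := is_lim_seq_div' _ _ _ _ La LF0 ltac:(lra)).
  assert (C : is_lim_seq (fun n => moda (INR (S n)) / F0 (modx (INR (S n)))) (moda h0 / F0 (modx h0))).
  { apply is_lim_seq_ext_loc with (fun _ => moda h0 / F0 (modx h0)); [|apply is_lim_seq_const].
    exists N; intros n Hn. apply Qc; auto. }
  apply is_lim_seq_unique in C. apply is_lim_seq_unique in LQ. rewrite LQ in C.
  injection C as C. destruct (mod_facts h0 Hh Hd) as [_ [_ [Hx _]]].
  assert (G := F0_ge_1 (modx h0) ltac:(lra)).
  replace (moda h0) with (moda h0 / F0 (modx h0) * F0 (modx h0)) by (field; lra).
  rewrite <- C. field.
Qed.

(** The given forms of Q and R make the discriminant positive and A / sqrt Q a root of the quartic
    in (1, 3); uniqueness of this root identifies A and l with [modA h] and [modx h]. *)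
Lemma moda_of_invariants (h A l : R) :
  0 < h -> 0 < A -> 0 < l < 1 ->
  eisQ h = A ^ 2 * (1 - 8 / 9 * l) ->
  eisR h = A ^ 3 * (1 - 4 / 3 * l + 8 / 27 * l ^ 2) ->
  sqrt A = F0 l.
Proof.
  intros Hh HA Hl EQ ER.
  destruct (sqQ_spec h Hh) as [Q0 Q1].
  assert (Hd : 0 < disc h).
  { unfold disc. rewrite EQ, ER.
    replace ((A ^ 2 * (1 - 8 / 9 * l)) ^ 3 - (A ^ 3 * (1 - 4 / 3 * l + 8 / 27 * l ^ 2)) ^ 2)
      with (64 / 729 * A ^ 6 * (l ^ 3 * (1 - l))) by field.
    apply Rmult_lt_0_compat; [assert (0 < A ^ 6) by (apply pow_lt; auto); lra|].
    apply Rmult_lt_0_compat; [apply pow_lt|]; lra. }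
  set (c0 := A / sqQ h).
  assert (Ec : 1 - 8 / 9 * l = / c0 ^ 2).
  { unfold c0. apply Rmult_eq_reg_l with (A ^ 2); [|apply pow_nonzero; lra].
    rewrite <- EQ, <- Q1. field. lra. }
  assert (c00 : 0 < c0) by (apply Rdiv_lt_0_compat; auto).
  assert (C2 : c0 ^ 2 * (1 - 8 / 9 * l) = 1) by (rewrite Ec; field; lra).
  assert (Hc : 1 < c0 < 3).
  { split; apply Rnot_le_lt; intros K.
    - assert (c0 ^ 2 <= 1) by (rewrite <- (pow1 2); apply pow_incr; lra). nra.
    - assert (3 ^ 2 <= c0 ^ 2) by (apply pow_incr; lra). nra. }
  assert (Sp : root_eq (eisR h / sqQ h ^ 3) c0).
  { split; auto. rewrite ER.
    replace l with (9 / 8 * (1 - / c0 ^ 2)) by lra.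
    replace A with (c0 * sqQ h) by (unfold c0; field; lra). field. lra. }
  assert (Em : modc h = c0).
  { apply (root_eq_unique (eisR h / sqQ h ^ 3)); auto. apply root_of_spec, ratio_bounds; auto. }
  assert (EA : modA h = A) by (unfold modA; rewrite Em; unfold c0; field; lra).
  assert (Ex : modx h = l) by (unfold modx; rewrite Em; lra).
  rewrite <- EA, <- Ex. apply moda_eq_F0; auto.
Qed.

Theorem theorem9 (kappa : R) (Omega Omega' : C) :
  0 < kappa < 1 ->
  let lambda := sqrt (1 - kappa ^ 2) in
  let G2 := 48 * (1 + 8 * kappa ^ 2) in
  let G3 := 64 * (1 - 20 * kappa ^ 2 - 8 * kappa ^ 4) in
  Im Omega = 0 -> 0 < Re Omega ->
  Re Omega' = 0 -> 0 < Im Omega' ->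
  has_invariants Omega Omega' G2 G3 ->
  Omega' = Cmult Ci (RtoC (1 / (6 * sqrt 2) * PI
                            * hyp2F1 (1/3) (2/3) 1 (lambda ^ 2))).
Proof.
  intros Hk lambda G2 G3 HI HR HR' HI' Hinv.
  destruct Omega as [Om o2], Omega' as [o1 s]. simpl in HI, HR, HR', HI'. subst o2 o1.
  assert (HP := PI_RGT_0).
  destruct (is_eisenstein_rectangular Om s G2 G3 HR HI' Hinv) as [E4 E6].
  set (h := 2 * (PI * Om / s)) in *.
  assert (Hh : 0 < h).
  { unfold h. apply Rmult_lt_0_compat; [lra|]. apply Rdiv_lt_0_compat; nra. }
  assert (El : lambda ^ 2 = 1 - kappa ^ 2).
  { unfold lambda. apply pow2_sqrt. nra. }
  set (l := lambda ^ 2) in *.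
  assert (Hl : 0 < l < 1) by (rewrite El; nra).
  (* 1 + 8 kappa^2 = 9 (1 - 8l/9) and 1 - 20 kappa^2 - 8 kappa^4 = - 27 (1 - 4l/3 + 8l^2/27).
     Comparison with Q gives A^2 = 5184 s^4/pi^4; with R, where the minus signs cancel, A^3 = 72^3
     s^6/pi^6. *)
  set (A := 72 * s ^ 2 / PI ^ 2).
  assert (s2 : 0 < s ^ 2) by (apply pow_lt; auto).
  assert (P2 : 0 < PI ^ 2) by (apply pow_lt; auto).
  assert (HA : 0 < A) by (apply Rdiv_lt_0_compat; lra).
  assert (EF : sqrt A = F0 l).
  { apply (moda_of_invariants h); auto.
    - replace (eisQ h) with (45 * (2 * s / PI) ^ 4 * (G2 / 60)).
      2:{ rewrite E4. field. lra. }
      unfold G2, A. replace (kappa ^ 2) with (1 - l) by lra. field. lra.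
    - replace (eisR h) with (- (945 / 2) * (2 * s / PI) ^ 6 * (G3 / 140)).
      2:{ rewrite E6. field. lra. }
      unfold G3, A. replace (kappa ^ 4) with ((kappa ^ 2) ^ 2) by ring.
      replace (kappa ^ 2) with (1 - l) by lra. field. lra. }
  assert (S2 : sqrt 2 * sqrt 2 = 2) by (apply sqrt_sqrt; lra).
  assert (S20 : 0 < sqrt 2) by (apply sqrt_lt_R0; lra).
  assert (EA : sqrt A = 6 * sqrt 2 * s / PI).
  { replace A with ((6 * sqrt 2 * s / PI) ^ 2).
    - apply sqrt_pow2. apply Rlt_le, Rdiv_lt_0_compat; auto.
      apply Rmult_lt_0_compat; lra.
    - unfold A. replace ((6 * sqrt 2 * s / PI) ^ 2) with
        (36 * (sqrt 2 * sqrt 2) * s ^ 2 / PI ^ 2) by (field; lra). rewrite S2. field. lra. }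
  rewrite hyp2F1_F0, <- EF, EA.
  unfold Cmult, Ci, RtoC; simpl. f_equal; field; lra.
Qed.
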